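(* Let $\mathcal V$ be a Borel set of closed subgroups of $S_\infty$ that is closed under conjugation in $S_\infty$. Suppose that for each $G\in\mathcal V$ we have a countably infinite set $\mathcal N_G$ of open subgroups of $G$ that forms a neighbourhood basis of $1$ in $G$. Suppose further that the relation $\mathcal T=\{(G,U)\colon G\in\mathcal V \text{ and } U\in\mathcal N_G\}$ is Borel, and that for all $G,H\in\mathcal V$, every topological group isomorphism $\phi\colon G\to H$ and every open subgroup $V$ of $G$, we have $V\in\mathcal N_G\Leftrightarrow\phi(V)\in\mathcal N_H$. For $G\in\mathcal V$ let $M_G$ be the structure whose universe is the (countable) set of all left cosets and right cosets in $G$ of subgroups in $\mathcal N_G$, in the language with a single ternary relation symbol $R$, where $R(A,B,C)$ holds if and only if $AB\subseteq C$. Then, identifying the universe of $M_G$ with $\omega$ via bijections $\nu_G\colon\omega\to \mathrm{dom}(M_G)$ that can be chosen in a Borel way from $G$, the function $G\mapsto M_G$ from $\mathcal V$ to the space of structures with domain $\omega$ and one ternary relation is Borel; and for all $G,H\in\mathcal V$, the groups $G$ and $H$ are topologically isomorphic if and only if $M_G\cong M_H$.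
   Context: $S_\infty$ is the Polish group of all permutations of $\omega$ with the topology of pointwise convergence. $\mathcal F(S_\infty)$ is the set of closed subsets of $S_\infty$ with the Effros Borel structure, i.e. the $\sigma$-algebra generated by the sets $\{D\in\mathcal F(S_\infty)\colon D\cap U\neq\emptyset\}$ for $U\subseteq S_\infty$ open. ''$\mathcal V$ is Borel'' means Borel as a subset of $\mathcal F(S_\infty)$, and ''$\mathcal T$ is Borel'' means Borel as a subset of $\mathcal F(S_\infty)^2$ (open subgroups of closed subgroups, and their cosets, are closed in $S_\infty$). ''Chosen in a Borel way'' means that $G\mapsto(\nu_G(n))_{n\in\omega}$ is a Borel function from $\mathcal V$ to $\mathcal F(S_\infty)^\omega$. The space of structures with domain $\omega$ and one ternary relation is the Polish space $\mathcal P(\omega^3)$. For $A,B\subseteq S_\infty$, $AB=\{a\circ b\colon a\in A, b\in B\}$. *)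

(* Defs.v *)
From HB Require Import structures.
From mathcomp Require Import all_boot all_order.
From mathcomp Require Import boolp classical_sets functions cardinality.
From mathcomp Require Import topology measurable_structure measurable_function.
Set Implicit Arguments.
Unset Strict Implicit.
Unset Printing Implicit Defensive.
Local Open Scope classical_set_scope.

(* The permutations of omega, with the subspace topology inherited from the
   topology of pointwise convergence on nat -> nat (nat being discrete). *)
Definition Sinf : Type := [set f : {ptws nat -> nat} | bijective f].

HB.instance Definition _ :=
  Topological.copy Sinf [set f : {ptws nat -> nat} | bijective f].

Definition sinf_fun (s : Sinf) : nat -> nat := val s.
Coercion sinf_fun : Sinf >-> Funclass.

Definition mk_sinf (f : nat -> nat) (bf : bijective f) : Sinf :=
  SigSub (mem_set (bf : [set f : {ptws nat -> nat} | bijective f] f)).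

Lemma sinf_bij (s : Sinf) : bijective s.
Proof. exact: set_valP s. Qed.

Lemma sinf_ext (s t : Sinf) : (forall n, s n = t n) -> s = t.
Proof. by move=> st; apply: val_inj; apply/funext. Qed.

Lemma sinf_inv_exists (s : Sinf) : {g : nat -> nat | cancel s g /\ cancel g s}.
Proof.
by apply: cid; case: (sinf_bij s) => g sg gs; exists g.
Qed.

Definition sinf_one : Sinf := @mk_sinf id (Bijective (fun=> erefl) (fun=> erefl)).
Definition sinf_mul (s t : Sinf) : Sinf :=
  mk_sinf (bij_comp (sinf_bij s) (sinf_bij t)).
Definition sinf_inv (s : Sinf) : Sinf :=
  mk_sinf (Bijective (svalP (sinf_inv_exists s)).2
                     (svalP (sinf_inv_exists s)).1).

Lemma sinf_mulA : associative sinf_mul.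
Proof. by move=> s t u; apply: sinf_ext. Qed.
Lemma sinf_mul1 : left_id sinf_one sinf_mul.
Proof. by move=> s; apply: sinf_ext. Qed.
Lemma sinf_1mul : right_id sinf_one sinf_mul.
Proof. by move=> s; apply: sinf_ext. Qed.
Lemma sinf_mulV : left_inverse sinf_one sinf_inv sinf_mul.
Proof.
by move=> s; apply: sinf_ext => n; exact: (svalP (sinf_inv_exists s)).1.
Qed.
Lemma sinf_Vmul : right_inverse sinf_one sinf_inv sinf_mul.
Proof.
by move=> s; apply: sinf_ext => n; exact: (svalP (sinf_inv_exists s)).2.
Qed.

HB.instance Definition _ :=
  isGroup.Build Sinf sinf_mulA sinf_mul1 sinf_1mul sinf_mulV sinf_Vmul.

Lemma sinf_mulE (s t : Sinf) (n : nat) : ((s * t)%g : Sinf) n = s (t n).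
Proof. by []. Qed.

(* The hyperspace F(S_infty); the empty set belongs to it. *)
Definition closedSinf : Type := [set D : set Sinf | closed D].

Definition set_of_closed (D : closedSinf) : set Sinf := val D.
Coercion set_of_closed : closedSinf >-> set.

Definition closedSinf0 : closedSinf :=
  SigSub (mem_set (closed0 : [set D : set Sinf | closed D] set0)).

HB.instance Definition _ := Choice.on closedSinf.
HB.instance Definition _ := isPointed.Build closedSinf closedSinf0.

Definition effros : set (set closedSinf) :=
  [set [set D : closedSinf | (D : set Sinf) `&` U !=set0] | U in open].

HB.instance Definition _ :=
  Measurable.copy closedSinf (g_sigma_algebraType effros).

(* Generators of the Borel structure of F(S_infty)^omega; F(S_infty) being a
   standard Borel space, this is the product sigma-algebra. *)
Definition cylinders : set (set (nat -> closedSinf)) :=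
  [set [set s | B (s n)] | n in [set: nat] & B in measurable].

(* The Polish space P(omega^3), a subset of omega^3 being identified with its
   characteristic function. *)
Definition ternary_omega : Type := {ptws nat * nat * nat -> bool}.
HB.instance Definition _ := Topological.on ternary_omega.
HB.instance Definition _ := isPointed.Build ternary_omega (fun=> false).

Definition borel_ternary_omega := g_sigma_algebraType (@open ternary_omega).
HB.instance Definition _ := Measurable.on borel_ternary_omega.

Section Subsets.
Local Open Scope group_scope.

Definition setmul (A B : set Sinf) : set Sinf :=
  [set a * b | a in A & b in B].

Definition is_subgroup (G : set Sinf) : Prop := group_closed (mem G).

Definition open_subgroup_of (G U : set Sinf) : Prop :=
  [/\ is_subgroup U, U `<=` G & exists2 O, open O & U = G `&` O].

(* [within G (nbhs 1)] is the filter of neighbourhoods of 1 in G, pushed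
   forward to S_infty. *)
Definition nbhs_basis1 (G : set Sinf) (B : set (set Sinf)) : Prop :=
  (forall U, B U -> U `<=` G /\ within G (nbhs (1 : Sinf)) U) /\
  (forall W, within G (nbhs (1 : Sinf)) W -> exists2 U, B U & U `<=` W).

(* Only the restriction of [phi] to G is meaningful. *)
Definition topgroup_iso (G H : set Sinf) (phi : Sinf -> Sinf) : Prop :=
  [/\ set_bij G H phi,
      forall x y, G x -> G y -> phi (x * y) = phi x * phi y,
      {within G, continuous phi} &
      exists2 psi : Sinf -> Sinf,
        forall x, G x -> psi (phi x) = x & {within H, continuous psi}].

Definition topgroup_isomorphic (G H : set Sinf) : Prop :=
  exists phi, topgroup_iso G H phi.

Definition cosets (G : set Sinf) (NG : set (set Sinf)) : set (set Sinf) :=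
  [set A | exists2 U, NG U & exists2 g, G g &
     A = [set g * u | u in U] \/ A = [set u * g | u in U]].

End Subsets.

Record ternary_structure := TernaryStructure {
  universe : Type;
  ternary_rel : universe -> universe -> universe -> Prop }.

Definition ternary_iso (M M' : ternary_structure) : Prop :=
  exists2 f : universe M -> universe M', bijective f &
    forall a b c, ternary_rel a b c <-> ternary_rel (f a) (f b) (f c).

Definition coset_structure (G : set Sinf) (NG : set (set Sinf)) :=
  @TernaryStructure (cosets G NG)
    (fun A B C => setmul (val A) (val B) `<=` val C).

Section Coding.
Variables (V : set closedSinf) (N : closedSinf -> set (set Sinf)).

(* [nu G] enumerates bijectively the universe of M_G (cosets of open subgroups
   of closed subgroups being closed, it takes its values in F(S_infty)), and
   G |-> nu G is a Borel function on V. *)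
Definition borel_enumeration (nu : closedSinf -> nat -> closedSinf) : Prop :=
  (forall G, V G ->
     set_bij [set: nat] (cosets G (N G)) (fun n => nu G n : set Sinf)) /\
  measurable_fun V (nu : closedSinf -> g_sigma_algebraType cylinders).

Definition coded_coset_structure (nu : closedSinf -> nat -> closedSinf)
    (G : closedSinf) : ternary_omega :=
  fun t => `[< setmul (nu G t.1.1) (nu G t.1.2) `<=` nu G t.2 >].

End Coding.

(* Main.v *)
Require Import Defs.
From mathcomp Require Import all_boot all_order.
From mathcomp Require Import boolp classical_sets functions cardinality.
From mathcomp Require Import topology measurable_structure measurable_function.
Set Implicit Arguments.
Unset Strict Implicit.
Unset Printing Implicit Defensive.
Local Open Scope classical_set_scope.

(** Both halves of the theorem rest on the fact that multiplication of
permutations is decided by finite approximations.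

Borel part.  A closed set D of permutations is coded by the family of basic open
sets that it meets ([hits D]); these coordinates generate the Effros structure,
and the codes are exactly the pruned trees of consistent nodes ([pruned_range]),
a Borel condition.  That A is a left coset of a member of N_G can be said without
quantifying over subgroups: for a closed subgroup U, a set A has the form gU exactly
when A is nonempty, the closure of A^-1 A is U and A U is contained in A
([left_coset_char]).  Right cosets are treated in the same way.  Hence
the relation of being a coset is the preimage of the given Borel relation
under a Borel map, intersected with a Borel set ([measurable_coset_relation]).
Its sections are countable and infinite, so the theorem of Lusin and Novikov
([lusin_novikov]) covers it by countably many graphs of Borel functions, and
deleting repetitions gives the enumeration ([borel_enumeration_exists]).
The relation AB contained in C is a countable Boolean combination of coordinates
([setmul_sub_hits]), so the coded structure is a Borel function of G.

The theorem of Lusin and Novikov is proved for an analytic relation P as follows.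
Call a set of pairs small if countably many graphs of total Borel functions
cover it.  The nodes of Baire space parametrize pieces of P; a finite
family of nodes is large if, whatever small set is removed, there is a point x above
which none of the corresponding pieces becomes empty.  If a node of a large family could not be
split into two nodes with disjoint second coordinates, then, off a small
set, its second coordinate would be a function of x with analytic graph; Lusin
separation, applied to each coordinate, extends it to a total Borel function, and
removing its graph contradicts largeness ([large_split]).  If P is not small, the
root is large, and splitting forever produces a perfect set of branches over a
single x, against countability of the section ([not_large_root]).  As the functions
are total, the domain where one of them selects an element of a Borel relation is the
preimage of that relation, hence Borel.

Isomorphism part.  A topological isomorphism acts on cosets.  Conversely an
isomorphism f of coset structures preserves everything expressible by R: being a
member of N_G (AA contained in A), inclusion, and being contained in a left or
right coset of U (some B has BA, or AB, contained in U).  For g in G the cosets containing g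
form a directed family of arbitrarily small sets, small on both sides, so their
images under f shrink to a single permutation, which lies in H because the cosets are
closed ([coset_iso_limit]).  This point belongs to f A only when g
belongs to A ([coset_iso_reflect]), which makes the construction
symmetric in G and H; the map so obtained is a topological isomorphism
([coset_iso_topgroup]).  Right cosets are also left cosets here, because
invariance under inner automorphisms makes N_G closed under conjugation. *)

(** * Choice and Borel formulas *)

Lemma dependent_choice_from (S : Type) (I : S -> Prop) (Q : S -> S -> Prop) s0 :
  I s0 -> (forall s, I s -> exists2 s', I s' & Q s s') ->
  exists f : nat -> S, [/\ f 0 = s0, forall n, I (f n) & forall n, Q (f n) (f n.+1)].
Proof.
move=> I0 next.
have /choice[g gP] : forall s, exists s', I s -> I s' /\ Q s s'.
  move=> s; have [Is|nIs] := pselect (I s); last by exists s.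
  by have [s' ? ?] := next s Is; exists s'.
have If n : I (iter n g s0) by elim: n => //= n IH; exact: (gP _ IH).1.
by exists (fun n => iter n g s0); split=> // n; exact: (gP _ (If n)).2.
Qed.

Lemma mkseqS (A : Type) (f : nat -> A) n : mkseq f n.+1 = rcons (mkseq f n) (f n).
Proof. by rewrite /mkseq -addn1 iotaD map_cat cats1. Qed.

Lemma branch_through (A : Type) (P : seq A -> Prop) s :
  P s -> (forall t, P t -> exists a, P (rcons t a)) ->
  exists f : nat -> A, mkseq f (size s) = s /\ forall n, size s <= n -> P (mkseq f n).
Proof.
move=> Ps next.
have [a0 _] := next _ Ps.
have [] := @dependent_choice_from _ P (fun t t' => exists a, t' = rcons t a) s Ps.
  by move=> t /next[a Pa]; exists (rcons t a) => //; exists a.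
move=> g [g0 gP gS].
have sg n : size (g n) = size s + n.
  by elim: n => [|n IH]; [rewrite g0 addn0|have [a ->] := gS n; rewrite size_rcons IH addnS].
have gpre n i : i < size s + n -> nth a0 (g n.+1) i = nth a0 (g n) i.
  by move=> lt; have [a ->] := gS n; rewrite nth_rcons sg lt.
pose f i := nth a0 (g i.+1) i.
have fE n : mkseq f (size s + n) = g n.
  apply: (@eq_from_nth _ a0); rewrite size_mkseq ?sg// => i lt_i.
  rewrite nth_mkseq// /f.
  suff stab m k : i < size s + m -> nth a0 (g (m + k)) i = nth a0 (g m) i.
    have [le|/ltnW le] := leqP n i.+1.
      by rewrite -(subnKC le) stab.
    by rewrite -(subnKC le) stab// (leq_trans _ (leq_addl _ _)).
  move=> lt; elim: k => [|k IH]; first by rewrite addn0.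
  by rewrite addnS gpre ?IH// (leq_trans lt)// leq_add2l leq_addr.
exists f; split; first by rewrite -[X in mkseq _ X]addn0 fE g0.
by move=> n le; rewrite -(subnKC le) fE.
Qed.

Section BorelFormulas.
Context {d : measure_display} {T : measurableType d}.
Implicit Types (P Q : T -> Prop) (I : countType).

Lemma measurable_exists I (R : I -> T -> Prop) :
  (forall i, measurable [set x | R i x]) -> measurable [set x | exists i, R i x].
Proof.
move=> mR; pose F n := if unpickle n is Some i then [set x | R i x] else set0.
suff -> : [set x | exists i, R i x] = \bigcup_n F n.
  by apply: bigcupT_measurable => n; rewrite /F; case: unpickle.
apply/seteqP; split=> x /=.
  by case=> i Ri; exists (pickle i) => //; rewrite /F pickleK.
by case=> n _; rewrite /F; case: unpickle => // i Ri; exists i.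
Qed.

Lemma measurable_equivP P Q : (forall x, P x <-> Q x) ->
  measurable [set x | Q x] -> measurable [set x | P x].
Proof. by move=> PQ; rewrite (_ : [set x | P x] = [set x | Q x])//; apply/seteqP; split=> x /PQ. Qed.

Lemma measurable_notP P : measurable [set x | P x] -> measurable [set x | ~ P x].
Proof. by move=> mP; apply: measurableC. Qed.

Lemma measurable_forall I (R : I -> T -> Prop) :
  (forall i, measurable [set x | R i x]) -> measurable [set x | forall i, R i x].
Proof.
move=> mR.
suff -> : [set x | forall i, R i x] = [set x | ~ exists i, ~ R i x].
  by apply/measurable_notP/measurable_exists => i; exact: measurable_notP.
apply/seteqP; split=> x /=; first by move=> Rx [i].
by move=> nR i; apply: contrapT => nRi; apply: nR; exists i.
Qed.

Lemma measurable_andP P Q : measurable [set x | P x] -> measurable [set x | Q x] ->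
  measurable [set x | P x /\ Q x].
Proof. by move=> mP mQ; exact: measurableI. Qed.

Lemma measurable_orP P Q : measurable [set x | P x] -> measurable [set x | Q x] ->
  measurable [set x | P x \/ Q x].
Proof. by move=> mP mQ; exact: measurableU. Qed.

Lemma measurable_implP P Q : measurable [set x | P x] -> measurable [set x | Q x] ->
  measurable [set x | P x -> Q x].
Proof.
move=> mP mQ; suff -> : [set x | P x -> Q x] = [set x | ~ P x \/ Q x].
  by apply: measurable_orP => //; exact: measurable_notP.
by apply/seteqP; split=> x /=; [by have [?|?] := pselect (P x); auto|case].
Qed.

Lemma measurable_iffP P Q : measurable [set x | P x] -> measurable [set x | Q x] ->
  measurable [set x | P x <-> Q x].
Proof. by move=> mP mQ; apply: measurable_andP; exact: measurable_implP. Qed.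

Lemma measurable_constP (p : Prop) : measurable [set _ : T | p].
Proof.
have [pT|npT] := pselect p.
  by rewrite (_ : [set _ | p] = setT) //; apply/seteqP; split.
by rewrite (_ : [set _ | p] = set0) //; apply/seteqP; split.
Qed.
End BorelFormulas.

(** * Analytic sets *)

Definition agree n (z z' : nat -> nat) := forall i, i < n -> z i = z' i.

Lemma agree_sym n z z' : agree n z z' -> agree n z' z.
Proof. by move=> zz' i /zz'. Qed.

Lemma agree_le n m z z' : n <= m -> agree m z z' -> agree n z z'.
Proof. by move=> nm zz' i /leq_trans/(_ nm)/zz'. Qed.

Lemma agree_mkseq n z z' : agree n z z' <-> mkseq z n = mkseq z' n.
Proof.
split=> [zz'|e i lt]; last by rewrite -(nth_mkseq 0 z lt) e nth_mkseq.
by apply: (@eq_from_nth _ 0); rewrite !size_mkseq// => i lt; rewrite !nth_mkseq ?zz'.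
Qed.

(** A point of Baire space read as a sequence of points of Baire space. *)
Definition unjoin (z : nat -> nat) (k : nat) := fun n : nat => z (pickle (k, n)).

Definition join (zs : nat -> nat -> nat) : nat -> nat :=
  fun m => if unpickle m is Some (k, n) then zs k n else 0.

Lemma joinK zs k : unjoin (join zs) k = zs k.
Proof. by apply/funext => n; rewrite /unjoin /join pickleK. Qed.

Lemma unjoin_cont k n :
  exists m, forall z z', agree m z z' -> agree n (unjoin z k) (unjoin z' k).
Proof.
exists (\max_(i < n) (pickle (k, nat_of_ord i)).+1) => z z' zz' i lt.
by apply: zz'; exact: (leq_bigmax (F := fun i : 'I_n => (pickle (k, nat_of_ord i)).+1) (Ordinal lt)).
Qed.

Definition baire_closed (D : set (nat -> nat)) :=
  forall z, (forall n, exists2 z', D z' & agree n z z') -> D z.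

Definition baire_continuous (T I : Type) (c : T -> I -> bool)
    (D : set (nat -> nat)) (phi : (nat -> nat) -> T) :=
  forall z, D z -> forall k, exists n, forall z', D z' -> agree n z z' ->
    c (phi z') k = c (phi z) k.

(** The coordinates [c] stand for an embedding of T in a Cantor cube, so that no
    topology on T is involved: continuity is asked coordinate by coordinate,
    relative to the closed set [D]. *)
Definition analytic (T I : Type) (c : T -> I -> bool) (A : set T) :=
  exists D phi, [/\ baire_closed D, baire_continuous c D phi & A = phi @` D].

Definition prod_coord (T T' I I' : Type) (c : T -> I -> bool) (c' : T' -> I' -> bool)
    (p : T * T') (k : I + I') : bool :=
  match k with inl i => c p.1 i | inr j => c' p.2 j end.

Lemma prod_coord_inj (T T' I I' : Type) (c : T -> I -> bool) (c' : T' -> I' -> bool) :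
  injective c -> injective c' -> injective (prod_coord c c').
Proof.
move=> ic ic' [x y] [x' y'] e; congr (_, _).
  by apply: ic; apply/funext => i; exact: (congr1 (fun h => h (inl i)) e).
by apply: ic'; apply/funext => i; exact: (congr1 (fun h => h (inr i)) e).
Qed.

Lemma neq_coord (T I : Type) (c : T -> I -> bool) : injective c ->
  forall x y, x <> y -> exists k, c x k <> c y k.
Proof.
move=> ic x y xy; apply: contrapT => nk; apply: xy; apply: ic; apply/funext => k.
by apply: contrapT => e; apply: nk; exists k.
Qed.

Lemma image_analytic (T T' I I' : Type) (c : T -> I -> bool) (c' : T' -> I' -> bool)
    (h : T -> T') A :
  (forall k', exists k, forall x, c' (h x) k' = c x k) ->
  analytic c A -> analytic c' (h @` A).
Proof.
move=> hc [D [phi [Dcl cphi ->]]]; exists D, (h \o phi); split=> //.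
  move=> z Dz k'; have [k hk] := hc k'; have [n cn] := cphi z Dz k.
  by exists n => z' Dz' zz'; rewrite /= !hk cn.
by rewrite image_comp.
Qed.

Section AnalyticOperations.
Context {T I : Type} (c : T -> I -> bool) (c_inj : injective c).

Lemma analytic_coord A k b : analytic c A -> analytic c (A `&` [set x | c x k = b]).
Proof.
move=> [D [phi [Dcl cphi ->]]].
exists (D `&` [set z | c (phi z) k = b]), phi; split.
- move=> z zz; have Dz : D z by apply: Dcl => n; have [z' [? _] ?] := zz n; exists z'.
  split=> //=; have [n cn] := cphi z Dz k.
  by have [z' [Dz' <-] zz'] := zz n; rewrite cn.
- move=> z [Dz _] k'; have [n cn] := cphi z Dz k'; exists n => z' [Dz' _]; exact: cn.
- apply/seteqP; split=> x; first by case=> -[z Dz <-] ck; exists z.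
  by case=> z [Dz ck <-]; split=> //; exists z.
Qed.

Lemma analytic_bigcup (A : nat -> set T) :
  (forall j, analytic c (A j)) -> analytic c [set x | exists j, A j x].
Proof.
move=> /choice[D] /choice[phi AD].
exists [set z | D (z 0) (z \o S)], (fun z => phi (z 0) (z \o S)).
have shift n z z' : agree n.+1 z z' -> z 0 = z' 0 /\ agree n (z \o S) (z' \o S).
  by move=> zz'; split=> [|i lt]; apply: zz'.
split.
- move=> z zz /=; have [Dcl _ _] := AD (z 0); apply: Dcl => n.
  have [z' Dz' /shift[z0 zz']] := zz n.+1.
  by exists (z' \o S) => //; rewrite z0.
- move=> z Dz k; have [_ cphi _] := AD (z 0); have [n cn] := cphi _ Dz k.
  exists n.+1 => z' /= Dz' /shift[z0 zz']; rewrite -z0 cn// z0//.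
- apply/seteqP; split=> x /=.
    case=> j; have [_ _ ->] := AD j; case=> z Dz <-.
    by exists (fun i => if i is i'.+1 then z i' else j).
  by case=> z Dz <-; exists (z 0); have [_ _ ->] := AD (z 0); exists (z \o S).
Qed.

(** The witness is a sequence of witnesses with a common image; this is a closed
    condition because the coordinates separate points. *)
Lemma analytic_bigcap (A : nat -> set T) :
  (forall j, analytic c (A j)) -> analytic c [set x | forall j, A j x].
Proof.
move=> /choice[D] /choice[phi AD].
pose E := [set z | (forall j, D j (unjoin z j)) /\
                   (forall j, phi j (unjoin z j) = phi 0 (unjoin z 0))].
exists E, (fun z => phi 0 (unjoin z 0)).
have cont z j k : D j (unjoin z j) -> exists n, forall z', D j (unjoin z' j) ->
    agree n z z' -> c (phi j (unjoin z' j)) k = c (phi j (unjoin z j)) k.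
  have [_ cphi _] := AD j; move=> Dz; have [n cn] := cphi _ Dz k.
  have [m sm] := unjoin_cont j n.
  by exists m => z' Dz' /sm zz'; apply: cn.
split.
- move=> z zz; have Dz j : D j (unjoin z j).
    have [Dcl _ _] := AD j; apply: Dcl => n; have [m sm] := unjoin_cont j n.
    by have [z' [Dz' _] /sm zz'] := zz m; exists (unjoin z' j).
  split=> // j; apply: c_inj; apply/funext => k.
  have [n cn] := cont z j k (Dz j); have [m cm] := cont z 0 k (Dz 0).
  have [z' [Dz' e] zz'] := zz (maxn n m).
  rewrite -(cn z')//; last exact: agree_le (leq_maxl _ _) zz'.
  by rewrite -(cm z')//; [rewrite e|exact: agree_le (leq_maxr _ _) zz'].
- move=> z [Dz _] k; have [n cn] := cont z 0 k (Dz 0).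
  by exists n => z' [Dz' _]; apply: cn.
- apply/seteqP; split=> x /=; last first.
    by case=> z [Dz e] <- j; have [_ _ ->] := AD j; exists (unjoin z j).
  move=> Ax; have /choice[zs zsP] : forall j, exists z, D j z /\ phi j z = x.
    by move=> j; have := Ax j; have [_ _ ->] := AD j; case=> z; exists z.
  exists (join zs); last by rewrite joinK; case: (zsP 0).
  by split=> j; rewrite joinK; case: (zsP j) => // _ ->; rewrite joinK; case: (zsP 0).
Qed.

Lemma analyticI A B : analytic c A -> analytic c B -> analytic c (A `&` B).
Proof.
move=> aA aB; have := @analytic_bigcap (fun j => if j is 0 then A else B).
rewrite (_ : [set x | _] = A `&` B); first by apply=> -[].
apply/seteqP; split=> x /=; first by move=> h; split; [exact: (h 0)|exact: (h 1)].
by case=> ? ? [|j].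
Qed.

Lemma analytic_set0 A : analytic c A -> analytic c set0.
Proof.
move=> [D [phi _]]; exists set0, phi; split=> //; last by rewrite image_set0.
by move=> z /(_ 0)[].
Qed.
End AnalyticOperations.

(** Closing under complements is the only obstacle to proving Borel sets analytic
    by induction, whence the symmetric condition. *)
Lemma bianalytic_sigma_algebra (T I : Type) (c : T -> I -> bool) : injective c ->
  analytic c setT ->
  sigma_algebra setT [set A | analytic c A /\ analytic c (~` A)].
Proof.
move=> c_inj aT; split.
- by split; [exact: analytic_set0 aT|rewrite setC0].
- by move=> A [aA anA]; rewrite setTD; split=> //; rewrite setCK.
- move=> A aA; split.
    rewrite (_ : \bigcup_n A n = [set x | exists j, A j x]).
      by apply: analytic_bigcup => j; case: (aA j).
    by apply/seteqP; split=> x /= [j]; [move=> _|]; exists j.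
  rewrite (_ : ~` _ = [set x | forall j, (~` A j) x]).
    by apply: analytic_bigcap => // j; case: (aA j).
  apply/seteqP; split=> x /=; first by move=> h j Aj; apply: h; exists j.
  by move=> h [j _]; exact: h.
Qed.

(** * Lusin separation *)

Definition cyl (u : seq nat) : set (nat -> nat) := [set z | mkseq z (size u) = u].

Lemma cyl_nil : cyl [::] = setT. Proof. by apply/seteqP; split. Qed.

Lemma cyl_rcons u i z : cyl (rcons u i) z <-> cyl u z /\ z (size u) = i.
Proof.
rewrite /cyl /= size_rcons mkseqS; split; last by case=> -> ->.
by move/eqP; rewrite eqseq_rcons => /andP[/eqP ? /eqP].
Qed.

Lemma cyl_mkseq z n z' : cyl (mkseq z n) z' <-> agree n z' z.
Proof. by rewrite agree_mkseq /cyl /= size_mkseq. Qed.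

Section Separation.
Context {d : measure_display} {T : measurableType d}.

Definition separable (A B : set T) :=
  exists M, [/\ measurable M, A `<=` M & forall x, B x -> ~ M x].

Lemma separable_bigcup (J : countType) (A B : J -> set T) :
  (forall i j, separable (A i) (B j)) ->
  separable [set x | exists i, A i x] [set x | exists j, B j x].
Proof.
move=> sAB; have /choice[M MP] : forall ij : J * J, exists M,
    [/\ measurable M, A ij.1 `<=` M & forall x, B ij.2 x -> ~ M x].
  by case=> i j; exact: sAB.
exists [set x | exists i, forall j, M (i, j) x]; split.
- by apply: measurable_exists => i; apply: measurable_forall => j; case: (MP (i, j)).
- by move=> x [i Aix]; exists i => j; case: (MP (i, j)) => _ + _; apply.
- by move=> x [j Bjx] [i /(_ j)]; case: (MP (i, j)) => _ _; apply.
Qed.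

(** If no Borel set separates A from B, descending through the nodes produces
    branches z and w all of whose pieces stay inseparable.  Their images
    lie in A and B, hence differ in a coordinate, and by continuity this
    coordinate separates two of the pieces. *)
Lemma lusin_separation (I : Type) (c : T -> I -> bool) A B :
  injective c -> (forall k, measurable [set x | c x k]) ->
  analytic c A -> analytic c B -> (forall x, A x -> ~ B x) -> separable A B.
Proof.
move=> c_inj mc [D [phi [Dcl cphi ->]]] [E [psi [Ecl cpsi ->]]] dAB.
apply: contrapT => nsep.
pose AA u := phi @` (D `&` cyl u); pose BB u := psi @` (E `&` cyl u).
pose P s := ~ separable (AA (unzip1 s)) (BB (unzip2 s)).
have [||f [_ Pf]] := @branch_through (nat * nat)%type P [::].
- by rewrite /P /AA /BB /= cyl_nil !setIT; exact: nsep.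
- move=> t Pt; apply: contrapT => nP; apply: Pt.
  have spl (F : set (nat -> nat)) (h : _ -> T) u :
      h @` (F `&` cyl u) = [set x | exists i, (h @` (F `&` cyl (rcons u i))) x].
    apply/seteqP; split=> x /=.
      by case=> z [Fz uz] <-; exists (z (size u)), z => //; rewrite cyl_rcons.
    by case=> i [z [Fz /cyl_rcons[uz _]] <-]; exists z.
  rewrite /AA /BB !spl; apply: separable_bigcup => i j.
  apply: contrapT => ns; apply: nP; exists (i, j).
  by rewrite /P /unzip1 /unzip2 !map_rcons.
pose z := fst \o f; pose w := snd \o f.
have {}Pf n : ~ separable (AA (mkseq z n)) (BB (mkseq w n)).
  by have := Pf n isT; rewrite /P /unzip1 /unzip2 -!map_comp.
have Dz : D z.
  apply: Dcl => n; apply: contrapT => nz; apply: (Pf n).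
  exists set0; split=> // [|x _ []].
  by move=> x [z' [Dz' /cyl_mkseq/agree_sym zz'] _]; case: nz; exists z'.
have Ew : E w.
  apply: Ecl => n; apply: contrapT => nz; apply: (Pf n).
  exists setT; split=> //.
  by move=> x [z' [Dz' /cyl_mkseq/agree_sym zz'] _]; case: nz; exists z'.
have [k ck] : exists k, c (phi z) k <> c (psi w) k.
  apply: neq_coord => // e; apply: (dAB (phi z)); first by exists z.
  by rewrite e; exists w.
have [n cn] := cphi z Dz k; have [m cm] := cpsi w Ew k.
apply: (Pf (maxn n m)); exists [set x | c x k = c (phi z) k]; split.
- case: (c (phi z) k); first exact: mc.
  rewrite (_ : [set x | _] = [set x | ~ c x k]); first exact: measurable_notP.
  by apply/seteqP; split=> x /=; case: (c x k).
- move=> _ [z' [Dz' /cyl_mkseq/agree_sym zz'] <-] /=; apply: cn => //.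
  exact: agree_le (leq_maxl _ _) zz'.
- move=> _ [z' [Dz' /cyl_mkseq/agree_sym zz'] <-] /=; rewrite (cm z')//.
    exact: nesym.
  exact: agree_le (leq_maxr _ _) zz'.
Qed.
End Separation.

(** * The Lusin-Novikov theorem *)

Definition node_lt (u v : seq nat) := size u < size v /\ take (size u) v = u.

Lemma node_lt_mkseq u z n : cyl u z -> size u < n -> node_lt u (mkseq z n).
Proof.
by move=> uz lt; split; rewrite ?size_mkseq// -map_take take_iota (minn_idPl (ltnW lt)).
Qed.

Lemma node_branch (u : nat -> seq nat) : (forall n, node_lt (u n) (u n.+1)) ->
  exists z, forall n, n <= size (u n) /\ cyl (u n) z.
Proof.
move=> lt_u; have szu n : n <= size (u n).
  by elim: n => // n IH; exact: leq_ltn_trans IH (lt_u n).1.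
have le_u n k : take (size (u n)) (u (n + k)) = u n /\ size (u n) <= size (u (n + k)).
  elim: k => [|k [IH le]]; first by rewrite addn0 take_size.
  have [lt' e] := lt_u (n + k); rewrite addnS; split; last exact: leq_trans le (ltnW lt').
  by rewrite -[in RHS]IH -[in RHS]e take_takel.
exists (fun i => nth 0 (u i.+1) i) => n; split=> //.
apply: (@eq_from_nth _ 0); rewrite ?size_mkseq// => i lt_i.
rewrite nth_mkseq//; have [le|/ltnW le] := leqP n i.+1.
  by have [<- _] := le_u n (i.+1 - n); rewrite subnKC// nth_take.
by have [<- _] := le_u i.+1 (n - i.+1); rewrite subnKC// nth_take.
Qed.

Section LusinNovikov.
Context {d d' : measure_display} {T : measurableType d} {Y : measurableType d'}.
Context {I : Type} {J : countType} (c : T -> I -> bool) (cY : Y -> J -> bool).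
Hypotheses (c_inj : injective c) (cY_inj : injective cY).
Hypothesis mc : forall k, measurable [set x | c x k].
Hypothesis mcY : forall k, measurable [set y | cY y k].

Let cc := prod_coord c cY.
Let cc_inj : injective cc. Proof. exact: prod_coord_inj. Qed.

Hypothesis borel_analytic : forall M : set (T * Y), measurable M -> analytic cc M.

(** Sets covered by such a union are the small sets.  The functions
    are total and take arbitrary codes as values, so that the points where they
    select an element of a Borel relation form a Borel set. *)
Definition graphs (f : nat -> T -> J -> bool) : set (T * Y) :=
  [set p | exists n, cY p.2 = f n p.1].

Definition borel_seq (f : nat -> T -> J -> bool) :=
  forall n k, measurable [set x | f n x k].

Let measurable_fst_set A : measurable A -> measurable [set p : T * Y | A p.1].
Proof.
move=> mA; rewrite (_ : [set p | _] = A `*` setT); first exact: measurableX.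
by apply/seteqP; split=> p //= [].
Qed.

Let measurable_snd_set A : measurable A -> measurable [set p : T * Y | A p.2].
Proof.
move=> mA; rewrite (_ : [set p | _] = setT `*` A); first exact: measurableX.
by apply/seteqP; split=> p //= [].
Qed.

Lemma measurable_graphs f : borel_seq f -> measurable (graphs f).
Proof.
move=> mf; rewrite (_ : graphs f = [set p | exists n, forall k, cY p.2 k <-> f n p.1 k]).
  apply: measurable_exists => n; apply: measurable_forall => k.
  by apply: measurable_iffP; [exact: measurable_snd_set (mcY k)
    |exact: measurable_fst_set (mf n k)].
apply/seteqP; split=> p /= [n]; first by move=> e; exists n => k; rewrite e.
by move=> e; exists n; apply/funext => k; apply/idP/idP => /e.
Qed.

Lemma graphs_union (K : countType) (F : K -> nat -> T -> J -> bool) :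
  (forall k, borel_seq (F k)) ->
  exists2 f, borel_seq f & forall k, graphs (F k) `<=` graphs f.
Proof.
move=> mF.
exists (fun m => if unpickle m is Some (k, n) then F k n else fun _ _ => false).
  move=> m j; case: unpickle => [[k n]|]; first exact: mF.
  exact: measurable_constP.
by move=> k p [n e]; exists (pickle (k, n)); rewrite pickleK.
Qed.

Lemma projection_analytic A : analytic cc A -> analytic c (fst @` A).
Proof. by apply: image_analytic => k; exists (inl k). Qed.

Let analyticT : analytic c setT.
Proof.
rewrite (_ : setT = fst @` [set: T * Y]).
  by apply: projection_analytic; exact: borel_analytic.
by apply/seteqP; split=> x // _; exists (x, point).
Qed.

Variables (D : set (nat -> nat)) (phi : (nat -> nat) -> T * Y).
Hypotheses (Dcl : baire_closed D) (cphi : baire_continuous cc D phi).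

Let piece u : set (T * Y) := phi @` (D `&` cyl u).

Let analytic_piece u : analytic cc (piece u).
Proof.
exists (D `&` cyl u), phi; split=> //.
  move=> z zz; split; first by apply: Dcl => n; have [z' [? _] ?] := zz n; exists z'.
  by have [z' [_ uz'] /agree_mkseq zz'] := zz (size u); rewrite /cyl /= zz'.
by move=> z [Dz _] k; have [n cn] := cphi Dz k; exists n => z' [Dz' _]; exact: cn.
Qed.

(** Above x, every piece named by [p] keeps a point outside the small set. *)
Definition alive (p : seq (seq nat)) f x :=
  forall u, u \in p -> exists2 y, piece u (x, y) & ~ graphs f (x, y).

Definition large (p : seq (seq nat)) := forall f, borel_seq f -> exists x, alive p f x.

Definition apart u v := forall z z', D z -> cyl u z -> D z' -> cyl v z' ->
  (phi z).2 <> (phi z').2.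

Lemma alive_le p q f g x : {subset q <= p} -> graphs f `<=` graphs g ->
  alive p g x -> alive q f x.
Proof.
by move=> qp fg ax u /qp /ax[y uy ngy]; exists y => // /fg.
Qed.

Lemma large_le p q : {subset q <= p} -> large p -> large q.
Proof. by move=> qp lp f /lp[x ax]; exists x; exact: alive_le qp _ ax. Qed.

Let analytic_alive_piece f u : borel_seq f -> analytic cc (piece u `&` ~` graphs f).
Proof.
move=> mf; apply: analyticI => //; apply: borel_analytic; apply: measurableC.
exact: measurable_graphs.
Qed.

Lemma analytic_alive p f : borel_seq f -> analytic c [set x | alive p f x].
Proof.
move=> mf; elim: p => [|u p IH].
  by rewrite (_ : [set x | _] = setT)//; apply/seteqP; split.
rewrite (_ : [set x | _] = fst @` (piece u `&` ~` graphs f) `&` [set x | alive p f x]).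
  apply: analyticI => //; apply: projection_analytic; exact: analytic_alive_piece.
apply/seteqP; split=> x /=.
  move=> ax; split; last by move=> v vp; apply: ax; rewrite inE vp orbT.
  by have [|y uy ny] := ax u; [rewrite mem_head|exists (x, y)].
case=> -[[x' y] [uy ny] <-] /= ax v; rewrite inE => /predU1P[->|/ax//].
by exists y.
Qed.

(** Suppose that every pair of separated extensions of u is killed by a small
    set, and let f collect these countably many sets.  If x is alive for p off f,
    all points above x in the piece of u, off f, have the same second coordinate.  For each
    coordinate k the sets A k true and A k false are therefore disjoint and analytic; Borel
    separators of them define a total function g through all these points, and
    f together with g kills u :: p. *)
Lemma large_split u p : large (u :: p) -> exists u' u'',
  [/\ node_lt u u', node_lt u u'', apart u' u'' & large [:: u', u'' & p]].
Proof.
move=> lup; apply: contrapT => nsplit.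
have /choice[F FP] : forall v : seq nat * seq nat, exists f, borel_seq f /\
    (node_lt u v.1 -> node_lt u v.2 -> apart v.1 v.2 ->
     forall x, ~ alive [:: v.1, v.2 & p] f x).
  move=> [u' u'']; have [[lt' lt'' ap]|nsep] :=
    pselect [/\ node_lt u u', node_lt u u'' & apart u' u'']; last first.
    exists (fun _ _ _ => false); split; first by move=> n k; exact: measurable_constP.
    by move=> ? ? ?; case: nsep.
  apply: contrapT => nf; apply: nsplit; exists u', u''; split=> // f mf.
  apply: contrapT => na; apply: nf; exists f; split=> // _ _ _ x ax.
  by apply: na; exists x.
have [f mf Ff] := graphs_union (fun v => (FP v).1).
pose A k b := [set x | alive p f x] `&`
  fst @` ((piece u `&` ~` graphs f) `&` [set q | cc q (inr k) = b]).
have aA k b : analytic c (A k b).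
  apply: analyticI => //; first exact: analytic_alive.
  by apply: projection_analytic; apply: analytic_coord; exact: analytic_alive_piece.
have dA k x : A k true x -> ~ A k false x.
  case=> ax [q [[[z [Dz uz] zq] nq] ck] qx] [_ [q' [[[z' [Dz' uz'] zq'] nq'] ck'] qx']].
  have [n cn] := cphi Dz (inr k); have [m cm] := cphi Dz' (inr k).
  pose N := maxn (size u).+1 (maxn n m).
  have uN : size u < N by rewrite leq_max ltnSn.
  have nN : n <= N by rewrite !leq_max leqnn orbT.
  have mN : m <= N by rewrite !leq_max leqnn !orbT.
  pose v := (mkseq z N, mkseq z' N).
  have [_ /(_ _ _ _ x)] := FP v; apply.
  - exact: node_lt_mkseq.
  - exact: node_lt_mkseq.
  - move=> w w' Dw /cyl_mkseq/agree_sym zw Dw' /cyl_mkseq/agree_sym zw' e.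
    have := cn w Dw (agree_le nN zw); have := cm w' Dw' (agree_le mN zw').
    by rewrite zq zq' ck ck' /cc /= e => ->.
  - move=> w; rewrite !inE => /or3P[/eqP->|/eqP->|wp].
    + exists q.2; last by rewrite -qx -surjective_pairing => /Ff.
      by exists z; [split; rewrite ?cyl_mkseq|rewrite zq -qx -surjective_pairing].
    + exists q'.2; last by rewrite -qx' -surjective_pairing => /Ff.
      by exists z'; [split; rewrite ?cyl_mkseq|rewrite zq' -qx' -surjective_pairing].
    + by have [y wy ny] := ax w wp; exists y => // /Ff.
have /choice[M MP] k := lusin_separation c_inj mc (aA k true) (aA k false) (@dA k).
pose g (n : nat) (x : T) k : bool := `[< M k x >].
have mg : borel_seq g.
  move=> n k; have [mM _ _] := MP k.
  by rewrite (_ : [set x | _] = M k)//; apply/seteqP; split=> x /= /asboolP.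
have [h mh fh] := graphs_union (F := fun b : bool => if b then f else g)
  (fun b => match b with true => mf | false => mg end).
have [x ax] := lup h mh.
have [y uy ny] := ax u (mem_head _ _).
apply: (ny); apply: (fh false); exists 0; apply/funext => k.
have Ax : A k (cY y k) x.
  split; first by apply: alive_le ax; [move=> w wp; rewrite inE wp orbT|exact: (fh true)].
  by exists (x, y) => //; split=> //; split=> // /(fh true).
have [_ Mt Mf] := MP k; rewrite /g /=.
case e: (cY y k) Ax => Ax; first by apply/esym/asboolP/Mt.
by apply/esym/asboolPn/Mf.
Qed.

Lemma large_split_all p : large p -> exists2 q, large q & forall u, u \in p ->
  exists u' u'', [/\ u' \in q, u'' \in q, node_lt u u', node_lt u u'' & apart u' u''].
Proof.
move=> lp; suff: forall r, large (p ++ r) -> exists2 q, large (q ++ r) &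
    forall u, u \in p -> exists u' u'',
      [/\ u' \in q, u'' \in q, node_lt u u', node_lt u u'' & apart u' u''].
  by move=> /(_ [::]); rewrite cats0 => /(_ lp)[q]; rewrite cats0; exists q.
(* r carries along the nodes that the induction does not split *)
elim: p {lp} => [|u p IH] r lp; first by exists [::].
have [] := IH (u :: r).
  by apply: large_le lp => w; rewrite !(mem_cat, inE) orbCA orbA.
move=> q lq qp; have [] := @large_split u (q ++ r).
  by apply: large_le lq => w; rewrite !(mem_cat, inE) orbCA.
move=> u' [u'' [uu' uu'' uapart luq]]; exists [:: u', u'' & q] => // w.
rewrite inE => /predU1P[->|/qp[w' [w'' [? ? ? ? ?]]]].
  by exists u', u''; rewrite !inE !eqxx orbT.
by exists w', w''; rewrite !inE; split=> //; apply/orP; right; apply/orP; right.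
Qed.

(** Splitting every node at every stage yields a tree of nodes.  Any two branches lie
    above the same x, since two nodes of the same stage have points above
    a common x.  If e injects the section above x into the integers, a
    branch can avoid at step n the point numbered n, as at most one of two
    separated nodes contains it; its limit is then outside the section. *)
Lemma not_large_root :
  (forall x, countable [set y | (phi @` D) (x, y)]) -> ~ large [:: [::]].
Proof.
move=> ctbl l0.
pose split_of (p q : seq (seq nat)) := forall u, u \in p ->
  exists u' u'', [/\ u' \in q, u'' \in q, node_lt u u', node_lt u u'' & apart u' u''].
have [||p [p0 lp pS]] := @dependent_choice_from _ large split_of [:: [::]] => //.
  exact: large_split_all.
have m0 : borel_seq (fun _ _ _ => false) by move=> n k; exact: measurable_constP.
pose path u := [/\ u 0 = [::], forall n, u n \in p n & forall n, node_lt (u n) (u n.+1)].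
have pathD u z : path u -> (forall n, n <= size (u n) /\ cyl (u n) z) -> D z.
  move=> [_ up _] uz; apply: Dcl => n; have [x ax] := lp n _ m0.
  have [y [z' [Dz' uz'] _] _] := ax _ (up n); exists z' => //.
  by have [le e] := uz n; move: uz'; rewrite -e => /cyl_mkseq/agree_sym; exact: agree_le.
have same_fst u z v w : path u -> path v ->
    (forall n, n <= size (u n) /\ cyl (u n) z) ->
    (forall n, n <= size (v n) /\ cyl (v n) w) -> (phi z).1 = (phi w).1.
  move=> pu pv uz vw; apply: c_inj; apply/funext => k.
  have Dz := pathD _ _ pu uz; have Dw := pathD _ _ pv vw.
  have [n cn] := cphi Dz (inl k); have [m cm] := cphi Dw (inl k).
  pose N := maxn n m; have [x ax] := lp N _ m0.
  have [_ up _] := pu; have [_ vp _] := pv.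
  have [y [z' [Dz' uz'] z'x] _] := ax _ (up N).
  have [y' [w' [Dw' vw'] w'x] _] := ax _ (vp N).
  have := cn z' Dz'; have := cm w' Dw'; rewrite /cc /= z'x w'x /= => <-; last first.
    have [le e] := vw N; move: vw'; rewrite -e => /cyl_mkseq/agree_sym.
    by apply: agree_le; exact: leq_trans (leq_maxr _ _) le.
  move=> <- //; have [le e] := uz N; move: uz'; rewrite -e => /cyl_mkseq/agree_sym.
  by apply: agree_le; exact: leq_trans (leq_maxl _ _) le.
have mkpath (Q : nat -> seq nat -> Prop) :
    (forall n u' u'', apart u' u'' -> Q n u' \/ Q n u'') ->
    exists2 u, path u & forall n, Q n (u n.+1).
  move=> Qn.
  have [||f [f0 fI fS]] := @dependent_choice_from (nat * seq nat)
      (fun s => s.2 \in p s.1)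
      (fun s t => [/\ t.1 = s.1.+1, node_lt s.2 t.2 & Q s.1 t.2]) (0, [::]).
  - by rewrite p0 mem_head.
  - move=> [n u] /= un; have [u' [u'' [u'p u''p uu' uu'' ap]]] := pS n u un.
    by have [Qu|Qu] := Qn n _ _ ap; [exists (n.+1, u')|exists (n.+1, u'')].
  have f1 n : (f n).1 = n by elim: n => [|n IH]; [rewrite f0|have [-> _ _] := fS n; rewrite IH].
  exists (fun n => (f n).2).
    split; first by rewrite f0.
      by move=> n; have := fI n; rewrite f1.
    by move=> n; have [_ ? _] := fS n.
  by move=> n; have [_ _] := fS n; rewrite f1.
have [|u0 pu0 _] := mkpath (fun _ _ => True); first by left.
have [z0 uz0] := node_branch (let: And3 _ _ h := pu0 in h).
have /countable_injP[e e_inj] := ctbl (phi z0).1.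
pose avoids n u := forall z, D z -> cyl u z -> (phi z).1 = (phi z0).1 -> e (phi z).2 <> n.
have [u pu av] : exists2 u, path u & forall n, avoids n (u n.+1).
  apply: (mkpath avoids) => n u' u'' ap; apply: contrapT => /not_orP[].
  move=> /existsNP[z] /not_implyP[Dz] /not_implyP[uz] /not_implyP[z1 /contrapT ez].
  move=> /existsNP[w] /not_implyP[Dw] /not_implyP[uw] /not_implyP[w1 /contrapT ew].
  apply: (ap z w) => //; apply: e_inj; rewrite ?ez ?ew// inE /=.
    by exists z => //; rewrite -z1 -surjective_pairing.
  by exists w => //; rewrite -w1 -surjective_pairing.
have [z uz] := node_branch (let: And3 _ _ h := pu in h).
apply: (av (e (phi z).2) z) => //; first exact: pathD uz.
  exact: (uz _).2.
exact: same_fst uz uz0.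
Qed.

End LusinNovikov.

(** If no sequence of graphs covers P, the root node is large. *)
Theorem lusin_novikov (d d' : measure_display) (T : measurableType d)
    (Y : measurableType d') (I : Type) (J : countType) (c : T -> I -> bool)
    (cY : Y -> J -> bool) :
  injective c -> injective cY ->
  (forall k, measurable [set x | c x k]) -> (forall k, measurable [set y | cY y k]) ->
  (forall M : set (T * Y), measurable M -> analytic (prod_coord c cY) M) ->
  forall P : set (T * Y), analytic (prod_coord c cY) P ->
  (forall x, countable [set y | P (x, y)]) ->
  exists2 f, borel_seq f & P `<=` graphs cY f.
Proof.
move=> c_inj cY_inj mc mcY bor P [D [phi [Dcl cphi ->]]] ctbl.
apply: contrapT => nf.
apply: (not_large_root c_inj cY_inj mc mcY bor Dcl cphi) => // f mf.
apply: contrapT => nx; apply: nf; exists f => // -[x y] [z Dz zxy].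
apply: contrapT => nxy; apply: nx; exists x => u; rewrite inE => /eqP ->.
by exists y => //; exists z.
Qed.

(** * Pointwise convergence and the topology of the symmetric group *)

Section Ptws.
Variables (X : topologicalType) (V : discreteUniformType) (pk : X -> nat).
Hypothesis pk_inj : injective pk.

Lemma nbhs_ptws (f : {ptws X -> V}) (O : set {ptws X -> V}) :
  nbhs f O <->
  exists n, forall g : {ptws X -> V}, (forall i, pk i < n -> g i = f i) -> O g.
Proof.
pose F := [set O : set {ptws X -> V} | exists n, forall g : {ptws X -> V},
  (forall i, pk i < n -> g i = f i) -> O g].
have FF : Filter F.
  split; first by exists 0.
  - move=> P Q [n hP] [m hQ]; exists (maxn n m) => g gf; split.
      by apply: hP => i lt; apply: gf; rewrite leq_max lt.
    by apply: hQ => i lt; apply: gf; rewrite leq_max lt orbT.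
  - by move=> P Q PQ [n hP]; exists n => g /hP /PQ.
split.
  suff : {ptws, F --> f} by apply.
  apply/pointwise_cvgP => t; apply/discrete_cvg.
  by exists (pk t).+1 => g gf /=; rewrite gf.
move=> [n hO].
have ev i : nbhs f [set g : {ptws X -> V} | g i = f i].
  have /pointwise_cvgP/(_ i) : {ptws, nbhs f --> f} by [].
  by move/discrete_cvg.
suff : nbhs f [set g : {ptws X -> V} | forall i, pk i < n -> g i = f i].
  by apply: filterS => g; exact: hO.
elim: {hO} n => [|n IH]; first by apply: filterS filterT.
have [[j pj]|nj] := pselect (exists j, pk j = n).
  apply: filterS (filterI IH (ev j)) => g [gn gj] i.
  by rewrite ltnS leq_eqVlt => /predU1P[|/gn//]; rewrite -pj => /pk_inj ->.
apply: filterS IH => g gn i; rewrite ltnS leq_eqVlt => /predU1P[e|/gn//].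
by case: nj; exists i.
Qed.
End Ptws.

Lemma nbhs_initial (S : choiceType) (T : topologicalType) (f : S -> T)
  (s : S) (O : set S) :
  nbhs (s : initial_topology f) O <-> exists2 B, nbhs (f s) B & f @^-1` B `<=` O.
Proof.
split=> [[B [[C Cop <-] Cfs CO]]|[B fB BO]].
  by exists C => //; apply: open_nbhs_nbhs.
by apply: filterS BO _; exact: initial_continuous fB.
Qed.

Lemma nbhs_sinf_fun (s : Sinf) (O : set Sinf) :
  nbhs s O <-> exists n, forall t : Sinf, (forall i, i < n -> t i = s i) -> O t.
Proof.
have := @nbhs_initial Sinf {ptws nat -> nat} val s O.
move=> [h1 h2]; split=> [/h1[B /nbhs_ptws-/(_ id (@inj_id nat))[n nB] BO]|[n nO]].
  by exists n => t ts; apply: BO; apply: nB.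
apply: h2; exists [set g : {ptws nat -> nat} | forall i, i < n -> g i = s i].
  by apply/(@nbhs_ptws _ _ id (@inj_id nat)); exists n.
exact: nO.
Qed.

Local Notation inv s := ((s^-1)%g : Sinf).

Lemma sinfK (s : Sinf) : cancel s (inv s).
Proof. by move=> i; rewrite -sinf_mulE mulVg. Qed.

Lemma sinfVK (s : Sinf) : cancel (inv s) s.
Proof. by move=> i; rewrite -sinf_mulE mulgV. Qed.

(** Approximating s together with its inverse makes the permutations a closed set of
    branches: a limit of permutations along values alone need not be onto. *)
Definition trunc (s : Sinf) n : seq (nat * nat) := mkseq (fun i => (s i, inv s i)) n.

Lemma trunc_eqP s t n :
  trunc t n = trunc s n <-> forall i, i < n -> t i = s i /\ inv t i = inv s i.
Proof.
split=> [e i lt|ts].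
  have := congr1 (fun l => nth (0, 0) l i) e.
  by rewrite /trunc !nth_mkseq// => -[-> ->].
apply: (@eq_from_nth _ (0, 0)); rewrite !size_mkseq// => i lt.
by rewrite !nth_mkseq//; have [-> ->] := ts i lt.
Qed.

Lemma size_trunc s n : size (trunc s n) = n. Proof. exact: size_mkseq. Qed.

Lemma trunc_le n m s t : n <= m -> trunc t m = trunc s m -> trunc t n = trunc s n.
Proof.
by move=> nm /trunc_eqP ts; apply/trunc_eqP => i lt; apply: ts; exact: leq_trans nm.
Qed.

Lemma nbhs_sinf (s : Sinf) (O : set Sinf) :
  nbhs s O <-> exists n, forall t : Sinf, trunc t n = trunc s n -> O t.
Proof.
rewrite nbhs_sinf_fun; split=> -[n nO].
  by exists n => t /trunc_eqP ts; apply: nO => i /ts[].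
exists (maxn n (\max_(i < n) (inv s i).+1)) => t ts; apply: nO; apply/trunc_eqP => i lt.
split; first by apply: ts; rewrite leq_max lt.
have ti : t (inv s i) = i.
  rewrite ts ?sinfVK// leq_max; apply/orP; right.
  exact: (leq_bigmax (F := fun i : 'I_n => (inv s i).+1) (Ordinal lt)).
by rewrite -{1}ti sinfK.
Qed.

Lemma trunc_nbhs s n : nbhs s [set t | trunc t n = trunc s n].
Proof. by apply/nbhs_sinf; exists n. Qed.

Definition ball_at (sg : seq (nat * nat)) : set Sinf := [set s | trunc s (size sg) = sg].

Lemma open_ball_at sg : open (ball_at sg).
Proof.
rewrite openE => s ss; apply/nbhs_sinf; exists (size sg) => t e.
by rewrite /ball_at /= e.
Qed.

Lemma ball_at_trunc s n t : ball_at (trunc s n) t <-> trunc t n = trunc s n.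
Proof. by rewrite /ball_at /= size_trunc. Qed.

Lemma closed_sinf (D : set Sinf) s : closed D ->
  (forall n, exists2 t, D t & trunc t n = trunc s n) -> D s.
Proof.
move=> + Ds; apply => B /nbhs_sinf[n nB]; have [t Dt ts] := Ds n.
by exists t; split=> //; exact: nB.
Qed.

Lemma closed_sinfP (D : set Sinf) :
  (forall s, (forall n, exists2 t, D t & trunc t n = trunc s n) -> D s) -> closed D.
Proof.
move=> h s clDs; apply: h => n; have [t [Dt ts]] := clDs _ (trunc_nbhs s n).
by exists t.
Qed.

Lemma trunc_mul s t n : exists m, forall s' t',
  trunc s' m = trunc s m -> trunc t' m = trunc t m ->
  trunc (s' * t')%g n = trunc (s * t)%g n.
Proof.
exists (maxn n (\max_(i < n) maxn (t i).+1 (inv s i).+1)) => s' t'.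
move=> /trunc_eqP ss /trunc_eqP tt; apply/trunc_eqP => i lt.
have le := leq_bigmax (F := fun i : 'I_n => maxn (t i).+1 (inv s i).+1) (Ordinal lt).
have lt' : i < maxn n (\max_(i < n) maxn (t i).+1 (inv s i).+1) by rewrite leq_max lt.
rewrite !invgM !sinf_mulE; split.
  rewrite (tt _ lt').1 (ss _ _).1// leq_max; apply/orP; right.
  by apply: leq_trans le; rewrite leq_max leqnn.
rewrite (ss _ lt').2 (tt _ _).2// leq_max; apply/orP; right.
by apply: leq_trans le; rewrite leq_max leqnn orbT.
Qed.

Lemma trunc_inv s t n : trunc t n = trunc s n -> trunc (t^-1)%g n = trunc (s^-1)%g n.
Proof.
by move=> /trunc_eqP ts; apply/trunc_eqP => i /ts[e e']; rewrite !invgK.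
Qed.

(** * Coordinates on the Effros Borel space *)

(** The coordinate of D at a node: whether D meets the basic open set. *)
Definition hits (D : closedSinf) (sg : seq (nat * nat)) : bool :=
  `[< exists2 s, (D : set Sinf) s & ball_at sg s >].

Lemma closedSinf_closed (D : closedSinf) : closed (D : set Sinf).
Proof. exact: set_valP D. Qed.

Definition mk_closedSinf (D : set Sinf) (clD : closed D) : closedSinf :=
  SigSub (mem_set (clD : [set D : set Sinf | closed D] D)).

Lemma mem_hits (D : closedSinf) s : (D : set Sinf) s <-> forall n, hits D (trunc s n).
Proof.
split=> [Ds n|h]; first by apply/asboolP; exists s => //; exact/ball_at_trunc.
apply: closed_sinf; first exact: closedSinf_closed.
by move=> n; have /asboolP[t Dt /ball_at_trunc ts] := h n; exists t.
Qed.

Lemma closedSinf_ext (D E : closedSinf) : (D : set Sinf) = E -> D = E.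
Proof. exact: val_inj. Qed.

Lemma hits_inj : injective hits.
Proof.
move=> D E DE; apply: closedSinf_ext; apply/seteqP.
by split=> s /mem_hits h; apply/mem_hits => n; [rewrite -DE|rewrite DE].
Qed.

Lemma measurable_hits sg : measurable [set D | hits D sg].
Proof.
apply: sub_sigma_algebra; exists (ball_at sg); first exact: open_ball_at.
by apply/seteqP; split=> D /=; [case=> s [Ds ss]; apply/asboolP; exists s
                              |move=> /asboolP[s ? ?]; exists s].
Qed.

Lemma hits_open (D : closedSinf) U : open U ->
  (D : set Sinf) `&` U !=set0 <-> exists sg, ball_at sg `<=` U /\ hits D sg.
Proof.
rewrite openE => oU; split=> [[s [Ds /oU/nbhs_sinf[n nU]]]|[sg [sU /asboolP[s Ds ss]]]].
  exists (trunc s n); split; first by move=> t /ball_at_trunc; exact: nU.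
  by apply/asboolP; exists s => //; exact/ball_at_trunc.
by exists s; split=> //; exact: sU.
Qed.

(** Every open set is a countable union of basic ones, so the coordinates generate
    the Effros structure. *)
Lemma measurable_fun_closedSinf d (T : measurableType d) (D : set T)
    (f : T -> closedSinf) : measurable D ->
  (forall sg, measurable (D `&` [set x | hits (f x) sg])) -> measurable_fun D f.
Proof.
move=> mD mf; apply: (measurability effros) => // _ [_ [U oU <-] <-].
rewrite (_ : _ `&` _ = [set x | exists sg, ball_at sg `<=` U /\ (D x /\ hits (f x) sg)]).
  apply: measurable_exists => sg; apply: measurable_andP; last exact: mf.
  exact: measurable_constP.
apply/seteqP; split=> x /=.
  by case=> Dx /hits_open-/(_ oU)[sg [? ?]]; exists sg.
by case=> sg [? [? ?]]; split=> //; apply/hits_open => //; exists sg.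
Qed.

Definition consistent (sg : seq (nat * nat)) := forall i j, i < size sg -> j < size sg ->
  ((nth (0, 0) sg i).1 = j <-> (nth (0, 0) sg j).2 = i).

Definition pruned (x : seq (nat * nat) -> bool) := forall sg,
  (x sg -> consistent sg) /\ (x sg <-> exists a, x (rcons sg a)).

Lemma consistent_trunc s n : consistent (trunc s n).
Proof.
move=> i j; rewrite size_trunc => lti ltj; rewrite !nth_mkseq//=.
by split=> <-; rewrite ?sinfK ?sinfVK.
Qed.

Lemma ball_at_rcons sg s : ball_at sg s <-> exists a, ball_at (rcons sg a) s.
Proof.
rewrite /ball_at /=; split=> [e|[a]].
  exists (s (size sg), inv s (size sg)).
  by rewrite size_rcons /trunc mkseqS -/(trunc _ _) e.
by rewrite size_rcons /trunc mkseqS => /eqP; rewrite eqseq_rcons => /andP[/eqP].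
Qed.

Lemma pruned_hits D : pruned (hits D).
Proof.
move=> sg; split; first by move=> /asboolP[s _ <-]; exact: consistent_trunc.
split=> [/asboolP[s Ds /ball_at_rcons[a sa]]|[a /asboolP[s Ds sa]]].
  by exists a; apply/asboolP; exists s.
by apply/asboolP; exists s => //; apply/ball_at_rcons; exists a.
Qed.

(** Pruning gives a branch through each node, and consistency makes its two
    components mutually inverse. *)
Lemma pruned_range x : pruned x -> exists D, hits D = x.
Proof.
move=> px; have clD : closed [set s : Sinf | forall n, x (trunc s n)].
  by apply: closed_sinfP => s h n; have [t /(_ n) + <-] := h n.
exists (mk_closedSinf clD); apply/funext => sg; apply/idP/idP.
  by move=> /asboolP[s /(_ (size sg)) + <-].
move=> xsg; have [] := @branch_through (nat * nat)%type (fun t => x t) sg xsg.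
  by move=> t xt; apply: (px t).2.1.
move=> f [fsg fx].
have {}fx n : x (mkseq f n).
  have [/fx//|/ltnW lt] := leqP (size sg) n.
  rewrite -(subnKC lt) in fsg; move: (size sg - n) fsg => k fsg.
  have: x (mkseq f (n + k)) by rewrite fsg.
  elim: k {fsg} => [|k IH]; first by rewrite addn0.
  by rewrite addnS mkseqS => xk; apply: IH; apply/(px _).2; exists (f (n + k)).
have fC i j : (f i).1 = j <-> (f j).2 = i.
  have := (px _).1 (fx (maxn i j).+1) i j; rewrite size_mkseq !ltnS leq_maxl leq_maxr.
  by rewrite !nth_mkseq ?ltnS ?leq_maxl ?leq_maxr//; apply.
have fK1 : cancel (fun i => (f i).1) (fun i => (f i).2) by move=> i; apply/fC.
have fK2 : cancel (fun i => (f i).2) (fun i => (f i).1) by move=> i; apply/fC.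
pose s := mk_sinf (Bijective fK1 fK2).
have sE i : s i = (f i).1 by [].
have sVE i : inv s i = (f i).2 by rewrite -{1}(fK2 i) -sE sinfK.
have sf n : trunc s n = mkseq f n.
  by apply: eq_mkseq => i; rewrite sVE sE -surjective_pairing.
by apply/asboolP; exists s; [move=> n; rewrite /= sf|rewrite /ball_at /= sf].
Qed.

Lemma measurable_pruned d (T : measurableType d) (f : T -> seq (nat * nat) -> bool) :
  (forall sg, measurable [set x | f x sg]) -> measurable [set x | pruned (f x)].
Proof.
move=> mf; apply: measurable_forall => sg; apply: measurable_andP.
  by apply: measurable_implP => //; exact: measurable_constP.
by apply: measurable_iffP => //; exact: measurable_exists.
Qed.

(** * Borel sets of pairs of closed sets are analytic *)

Lemma analyticX (T T' I I' : Type) (c : T -> I -> bool) (c' : T' -> I' -> bool) A B :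
  analytic c A -> analytic c' B -> analytic (prod_coord c c') (A `*` B).
Proof.
move=> [D [phi [Dcl cphi ->]]] [E [psi [Ecl cpsi ->]]].
exists [set z | D (unjoin z 0) /\ E (unjoin z 1)], (fun z => (phi (unjoin z 0), psi (unjoin z 1))).
split.
- move=> z zz; split; [apply: Dcl|apply: Ecl] => n.
    have [m sm] := unjoin_cont 0 n; have [z' [Dz' _] /sm zz'] := zz m.
    by exists (unjoin z' 0).
  have [m sm] := unjoin_cont 1 n; have [z' [_ Ez'] /sm zz'] := zz m.
  by exists (unjoin z' 1).
- move=> z [Dz Ez] [k|k] /=.
    have [n cn] := cphi _ Dz k; have [m sm] := unjoin_cont 0 n.
    by exists m => z' [Dz' _] /sm; exact: cn.
  have [n cn] := cpsi _ Ez k; have [m sm] := unjoin_cont 1 n.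
  by exists m => z' [_ Ez'] /sm; exact: cn.
- apply/seteqP; split=> -[x y] /=.
    case=> -[z Dz <-] [w Ew <-].
    by exists (join (fun k => if k is 0 then z else w)); rewrite !joinK.
  by case=> z [Dz Ez] [<- <-]; split; [exists (unjoin z 0)|exists (unjoin z 1)].
Qed.

(** A pruned tree is presented by a point z of Baire space that also witnesses pruning: z is 0
    off the tree and one more than the code of a label leading to a successor on it.
    The conditions on z are then closed. *)
Lemma analytic_closedSinf : analytic hits setT.
Proof.
pose x (z : nat -> nat) (sg : seq (nat * nat)) := z (pickle sg) != 0.
pose D : set (nat -> nat) := [set z | forall sg,
  [/\ x z sg -> consistent sg, forall a, x z (rcons sg a) -> x z sg,
      forall a, z (pickle sg) = (@pickle (nat * nat)%type a).+1 -> x z (rcons sg a) &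
      x z sg -> exists a, z (pickle sg) = (@pickle (nat * nat)%type a).+1]].
have Dpruned z : D z -> pruned (x z).
  move=> Dz sg; have [h1 h2 h3 h4] := Dz sg; split=> //.
  by split=> [/h4[a /h3 ?]|[a /h2//]]; exists a.
have /choice[phi phiP] : forall z, exists E, D z -> hits E = x z.
  move=> z; have [/Dpruned/pruned_range[E EE]|nD] := pselect (D z); last by exists closedSinf0.
  by exists E.
exists D, phi; split.
- move=> z zz sg.
  have loc a : exists2 z', D z' & z' (pickle sg) = z (pickle sg) /\
      z' (pickle (rcons sg a)) = z (pickle (rcons sg a)).
    have [z' Dz' zz'] := zz (maxn (pickle sg) (pickle (rcons sg a))).+1.
    by exists z' => //; rewrite !zz' ?ltnS ?leq_maxl ?leq_maxr.
  rewrite /x; split.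
  + have [z' /(_ sg)[h _ _ _] [e _]] := loc (0, 0).
    by move: h; rewrite /x e.
  + by move=> a; have [z' /(_ sg)[_ /(_ a) h _ _] [e e']] := loc a; move: h; rewrite /x e e'.
  + by move=> a; have [z' /(_ sg)[_ _ /(_ a) h _] [e e']] := loc a; move: h; rewrite /x e e'.
  + by have [z' /(_ sg)[_ _ _ h] [e _]] := loc (0, 0); move: h; rewrite /x e.
- move=> z Dz sg; exists (pickle sg).+1 => z' Dz' zz'.
  by rewrite !phiP// /x zz'.
- apply/seteqP; split=> // E _.
  have /choice[w wP] : forall sg, exists n, (hits E sg <-> n <> 0) /\
      (hits E sg -> exists2 a, n = (@pickle (nat * nat)%type a).+1 & hits E (rcons sg a)).
    move=> sg; case e: (hits E sg); last by exists 0.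
    by have [a Ea] := (pruned_hits E sg).2.1 e; exists (pickle a).+1; split=> // _; exists a.
  pose z n := if unpickle n is Some sg then w sg else 0.
  have zE sg : z (pickle sg) = w sg by rewrite /z pickleK.
  have xE sg : x z sg = hits E sg.
    by rewrite /x zE; apply/idP/idP => [/eqP/((wP sg).1)|/((wP sg).1)/eqP].
  have Dz : D z.
    move=> sg; rewrite !xE; have [h1 h2] := pruned_hits E sg; split=> //.
    + by move=> a; rewrite xE => Ea; apply/h2; exists a.
    + move=> a; rewrite xE zE => wa; have [h3 h4] := wP sg.
      have /h4[b] : hits E sg by apply/h3; rewrite wa.
      by rewrite wa => -[/(pcan_inj pickleK) ->].
    + by move=> /(wP sg).2[a e _]; exists a; rewrite zE.
  by exists z => //; apply: hits_inj; rewrite phiP//; apply/funext => sg; rewrite xE.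
Qed.

(** The sets that are analytic together with their complement form a sigma-algebra
    for which both projections are measurable. *)
Lemma borel_analytic_closedSinf (M : set (closedSinf * closedSinf)) :
  measurable M -> analytic (prod_coord hits hits) M.
Proof.
set cc := prod_coord hits hits.
have cc_inj : injective cc by apply: prod_coord_inj; exact: hits_inj.
have aT : analytic cc setT.
  by rewrite -setXTT; apply: analyticX; exact: analytic_closedSinf.
pose CC : set (set (closedSinf * closedSinf)) := [set A | analytic cc A /\ analytic cc (~` A)].
have sCC : sigma_algebra setT CC by exact: bianalytic_sigma_algebra.
pose W := g_sigma_algebraType CC.
have mW (A : set W) : measurable A <-> CC A.
  by rewrite /measurable/= sigma_algebra_id.
have coordW k : measurable [set p : W | cc p k].
  apply/mW; split.
    by rewrite -[X in analytic _ X]setTI; exact: analytic_coord.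
  rewrite (_ : ~` _ = setT `&` [set p | cc p k = false]); first exact: analytic_coord.
  by apply/seteqP; split=> p /= => [/negP/negbTE|[_ ->]].
have m1 : measurable_fun setT (fst : W -> closedSinf).
  by apply: measurable_fun_closedSinf => // sg; rewrite setTI; exact: coordW (inl sg).
have m2 : measurable_fun setT (snd : W -> closedSinf).
  by apply: measurable_fun_closedSinf => // sg; rewrite setTI; exact: coordW (inr sg).
rewrite measurable_prod_measurableType => sM.
suff : CC M by case.
apply: smallest_sub sM => // _ [A mA [B mB <-]]; apply/mW.
rewrite (_ : A `*` B = (setT `&` fst @^-1` A) `&` (setT `&` snd @^-1` B)).
  by apply: measurableI; [exact: m1|exact: m2].
by rewrite !setTI; apply/seteqP; split=> p [].
Qed.

(** * Cosets of open subgroups *)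

Lemma is_subgroupP (G : set Sinf) : is_subgroup G <->
  [/\ G 1%g, forall x y, G x -> G y -> G (x * y)%g & forall x, G x -> G (x^-1)%g].
Proof.
split=> [[G1 GB]|[G1 GM GV]].
  have {}GB x y : G x -> G y -> G (x * y^-1)%g.
    by move=> Gx Gy; apply: (set_mem (GB x y (mem_set Gx) (mem_set Gy))).
  have G1' : G 1%g by exact: set_mem G1.
  have GV x : G x -> G (x^-1)%g by move=> Gx; rewrite -[_^-1%g]mul1g; exact: GB.
  by split=> // x y Gx Gy; rewrite -[y]invgK; apply: GB => //; exact: GV.
split; first exact: mem_set.
by move=> x y /set_mem Gx /set_mem Gy; apply: mem_set; apply: GM => //; exact: GV.
Qed.

Lemma subgroup1 G : is_subgroup G -> G 1%g.
Proof. by case/is_subgroupP. Qed.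

Lemma subgroupM G x y : is_subgroup G -> G x -> G y -> G (x * y)%g.
Proof. by case/is_subgroupP => _ h _; exact: h. Qed.

Lemma subgroupV G x : is_subgroup G -> G x -> G (x^-1)%g.
Proof. by case/is_subgroupP => _ _; exact. Qed.

Definition lcoset (g : Sinf) (U : set Sinf) : set Sinf := [set (g * u)%g | u in U].
Definition rcoset (U : set Sinf) (g : Sinf) : set Sinf := [set (u * g)%g | u in U].

Lemma lcosetP g U x : lcoset g U x <-> U (g^-1 * x)%g.
Proof. by split=> [[u Uu <-]|Ux]; [rewrite mulKg|exists (g^-1 * x)%g; rewrite ?mulVKg]. Qed.

Lemma rcosetP g U x : rcoset U g x <-> U (x * g^-1)%g.
Proof. by split=> [[u Uu <-]|Ux]; [rewrite mulgK|exists (x * g^-1)%g; rewrite ?mulgVK]. Qed.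

Lemma lcoset_eq U a b : is_subgroup U -> lcoset a U b -> lcoset a U = lcoset b U.
Proof.
move=> sU /lcosetP ab; apply/seteqP; split=> x /lcosetP ax; apply/lcosetP.
  rewrite -[x](mulVKg a) mulgA -[X in (X * _)%g]invgK invgM invgK.
  exact: subgroupM (subgroupV sU ab) ax.
by rewrite -[x](mulVKg b) mulgA; exact: subgroupM ab ax.
Qed.

Lemma rcoset_eq U a b : is_subgroup U -> rcoset U a b -> rcoset U a = rcoset U b.
Proof.
move=> sU /rcosetP ab; apply/seteqP; split=> x /rcosetP ax; apply/rcosetP.
  rewrite -[x](mulgVK a) -mulgA -[X in (_ * X)%g]invgK invgM invgK.
  exact: subgroupM ax (subgroupV sU ab).
by rewrite -[x](mulgVK b) -mulgA; exact: subgroupM ax ab.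
Qed.

Lemma closed_lcoset g U : closed U -> closed (lcoset g U).
Proof.
move=> cU; apply: closed_sinfP => s sU; apply/lcosetP; apply: (closed_sinf cU) => n.
have [m sm] := trunc_mul (g^-1)%g s n; have [t /lcosetP gt ts] := sU m.
by exists (g^-1 * t)%g => //; exact: sm.
Qed.

Lemma closed_rcoset g U : closed U -> closed (rcoset U g).
Proof.
move=> cU; apply: closed_sinfP => s sU; apply/rcosetP; apply: (closed_sinf cU) => n.
have [m sm] := trunc_mul s (g^-1)%g n; have [t /rcosetP gt ts] := sU m.
by exists (t * g^-1)%g => //; exact: sm.
Qed.

Lemma trunc_div s n : exists m, forall t, trunc t m = trunc s m ->
  trunc (s^-1 * t)%g n = trunc 1%g n /\ trunc (t * s^-1)%g n = trunc 1%g n.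
Proof.
have [m1 h1] := trunc_mul (s^-1)%g s n; have [m2 h2] := trunc_mul s (s^-1)%g n.
exists (maxn m1 m2) => t ts; split.
  by rewrite h1 ?mulVg//; exact: trunc_le (leq_maxl _ _) ts.
by rewrite h2 ?mulgV//; exact: trunc_le (leq_maxr _ _) ts.
Qed.

(** The combinatorial form of openness: U contains the elements of G close to 1. *)
Lemma open_subgroup_ball G U : open_subgroup_of G U ->
  exists n, forall x, G x -> trunc x n = trunc 1%g n -> U x.
Proof.
move=> [sU UG [O oO UO]].
have [_ O1] : (G `&` O) 1%g by rewrite -UO; exact: subgroup1.
have /nbhs_sinf[n nO] : nbhs (1%g : Sinf) O by move: oO; rewrite openE; exact.
by exists n => x Gx x1; rewrite UO; split=> //; exact: nO.
Qed.

Lemma open_subgroup_closed G U : closed G -> is_subgroup G ->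
  open_subgroup_of G U -> closed U.
Proof.
move=> cG sG oU; have [n nU] := open_subgroup_ball oU; have [sU UG _] := oU.
apply: closed_sinfP => s hs.
have Gs : G s.
  by apply: (closed_sinf cG) => k; have [t Ut ts] := hs k; exists t => //; exact: UG.
have [m hm] := trunc_div s n; have [t Ut /hm[tn _]] := hs m.
rewrite -[s](mulVKg t) -[(t^-1 * s)%g]invgK invgM invgK.
apply: subgroupM => //; apply: subgroupV => //; apply: nU => //.
by apply: subgroupM => //; [exact: subgroupV|exact: UG].
Qed.

Record subgroup_family (G : set Sinf) (NG : set (set Sinf)) : Prop := SubgroupFamily {
  sf_closed : closed G;
  sf_group : is_subgroup G;
  sf_open : forall U, NG U -> open_subgroup_of G U }.

Section Cosets.
Variables (G : set Sinf) (NG : set (set Sinf)).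
Hypothesis GN : subgroup_family G NG.
Let cG := sf_closed GN.
Let sG := sf_group GN.

Lemma sub_family U : NG U -> U `<=` G.
Proof. by move=> /(sf_open GN)[]. Qed.

Lemma subgroup_family_sub U : NG U -> is_subgroup U.
Proof. by move=> /(sf_open GN)[]. Qed.

Lemma cosetsP A : cosets G NG A <->
  (exists2 U, NG U & exists2 g, G g & A = lcoset g U) \/
  (exists2 U, NG U & exists2 g, G g & A = rcoset U g).
Proof.
split=> [[U NU [g Gg [->|->]]]|[[U NU [g Gg ->]]|[U NU [g Gg ->]]]].
- by left; exists U => //; exists g.
- by right; exists U => //; exists g.
- by exists U => //; exists g => //; left.
- by exists U => //; exists g => //; right.
Qed.

Lemma closed_coset A : cosets G NG A -> closed A.
Proof.
move=> /cosetsP[|] [U /(sf_open GN) oU [g _ ->]].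
  by apply: closed_lcoset; exact: open_subgroup_closed oU.
by apply: closed_rcoset; exact: open_subgroup_closed oU.
Qed.

Lemma sub_coset A : cosets G NG A -> A `<=` G.
Proof.
move=> /cosetsP[|] [U /sub_family UG [g Gg ->]] _ [u /UG Gu <-]; exact: subgroupM.
Qed.

Lemma lcoset_coset U g : NG U -> G g -> cosets G NG (lcoset g U).
Proof. by move=> NU Gg; apply/cosetsP; left; exists U => //; exists g. Qed.

Lemma rcoset_coset U g : NG U -> G g -> cosets G NG (rcoset U g).
Proof. by move=> NU Gg; apply/cosetsP; right; exists U => //; exists g. Qed.

Lemma lcoset1 (U : set Sinf) : lcoset 1%g U = U.
Proof. by apply/seteqP; split=> x; rewrite lcosetP invg1 mul1g. Qed.

Lemma family_coset U : NG U -> cosets G NG U.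
Proof. by move=> NU; rewrite -[U]lcoset1; apply: lcoset_coset => //; exact: subgroup1. Qed.

Definition lquotients (A : set Sinf) : set Sinf :=
  [set x | exists a b, [/\ A a, A b & x = (a^-1 * b)%g]].
Definition rquotients (A : set Sinf) : set Sinf :=
  [set x | exists a b, [/\ A a, A b & x = (a * b^-1)%g]].

(** For A = gU the quotients a^-1 b run through U, which is closed.  Conversely, let U
    be the closure of the quotients and g in A: then g^-1 A is contained in U, and gU in A
    by the last condition, so A = gU. *)
Lemma left_coset_char A :
  (exists2 U, NG U & exists2 g, G g & A = lcoset g U) <->
  [/\ A !=set0, A `<=` G, NG (closure (lquotients A)) &
      setmul A (closure (lquotients A)) `<=` A].
Proof.
split=> [[U NU [g Gg ->]]|[[g Ag] AG NQ AQ]].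
  have sU := subgroup_family_sub NU.
  have QU : closure (lquotients (lcoset g U)) = U.
    suff -> : lquotients (lcoset g U) = U.
      by apply/esym/closure_id; exact: open_subgroup_closed (sf_open GN NU).
    apply/seteqP; split=> [x [a [b [/lcosetP Ua /lcosetP Ub ->]]]|u Uu].
      have -> : (a^-1 * b = (g^-1 * a)^-1 * (g^-1 * b))%g.
        by rewrite invgM invgK !mulgA mulgK.
      exact: subgroupM (subgroupV sU Ua) Ub.
    exists g, (g * u)%g; split; last by rewrite mulKg.
      by apply/lcosetP; rewrite mulVg; exact: subgroup1.
    by exists u.
  rewrite QU; split=> //.
  - by exists g; apply/lcosetP; rewrite mulVg; exact: subgroup1.
  - by apply: sub_coset; exact: lcoset_coset.
  - move=> _ [a [u Uu <-] [v Uv <-]]; exists (u * v)%g; last by rewrite mulgA.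
    exact: subgroupM.
exists (closure (lquotients A)) => //; exists g; first exact: AG.
apply/seteqP; split=> x.
  move=> Ax; apply/lcosetP; apply: subset_closure; exists g, x; split=> //.
by case=> u Qu <-; apply: AQ; exists g => //; exists u.
Qed.

Lemma right_coset_char A :
  (exists2 U, NG U & exists2 g, G g & A = rcoset U g) <->
  [/\ A !=set0, A `<=` G, NG (closure (rquotients A)) &
      setmul (closure (rquotients A)) A `<=` A].
Proof.
split=> [[U NU [g Gg ->]]|[[g Ag] AG NQ AQ]].
  have sU := subgroup_family_sub NU.
  have QU : closure (rquotients (rcoset U g)) = U.
    suff -> : rquotients (rcoset U g) = U.
      by apply/esym/closure_id; exact: open_subgroup_closed (sf_open GN NU).
    apply/seteqP; split=> [x [a [b [/rcosetP Ua /rcosetP Ub ->]]]|u Uu].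
      have -> : (a * b^-1 = (a * g^-1) * (b * g^-1)^-1)%g.
        by rewrite invgM invgK !mulgA mulgVK.
      exact: subgroupM Ua (subgroupV sU Ub).
    exists (u * g)%g, g; split; last by rewrite mulgK.
      by exists u.
    by apply/rcosetP; rewrite mulgV; exact: subgroup1.
  rewrite QU; split=> //.
  - by exists g; apply/rcosetP; rewrite mulgV; exact: subgroup1.
  - by apply: sub_coset; exact: rcoset_coset.
  - move=> _ [v Uv [_ [u Uu <-] <-]]; exists (v * u)%g; last by rewrite mulgA.
    exact: subgroupM.
exists (closure (rquotients A)) => //; exists g; first exact: AG.
apply/seteqP; split=> x.
  move=> Ax; apply/rcosetP; apply: subset_closure; exists x, g; split=> //.
by case=> u Qu <-; apply: AQ; exists u => //; exists g.
Qed.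

Lemma countable_keyed (S : Type) (B : set S) (K : choiceType) (K' : countType)
    (L : set K) (R : S -> K * K' -> Prop) : countable L ->
  (forall x, B x -> exists k, L k.1 /\ R x k) ->
  (forall x y k, L k.1 -> R x k -> R y k -> x = y) -> countable B.
Proof.
move=> /countable_injP[e e_inj] Rex Runiq.
have /choice[f fP] : forall x, exists k : nat, B x -> exists2 q, L q.1 /\ R x q &
    k = pickle (e q.1, q.2).
  move=> x; have [Bx|nBx] := pselect (B x); last by exists 0.
  by have [q ?] := Rex x Bx; exists (pickle (e q.1, q.2)) => _; exists q.
apply/countable_injP; exists f => x y /set_mem Bx /set_mem By fxy.
have [[k1 k2] [/= Lk Rk] fx] := fP x Bx; have [[l1 l2] [/= Ll Rl] fy] := fP y By.
have [ekl kl2] : (e k1, k2) = (e l1, l2).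
  by apply: (pcan_inj pickleK); rewrite -fx -fy.
have kl1 : k1 = l1 by apply: e_inj; rewrite ?inE.
by apply: (Runiq _ _ (k1, k2)) => //; rewrite kl1 kl2.
Qed.

(** A coset contains all elements of G in some basic open ball around one of its
    points; the subgroup, the side and the ball determine it. *)
Lemma countable_cosets : countable NG -> countable (cosets G NG).
Proof.
move=> cN.
pose R (A : set Sinf) (k : set Sinf * (bool * seq (nat * nat))) := exists g,
  [/\ G g, A = (if k.2.1 then lcoset g k.1 else rcoset k.1 g), ball_at k.2.2 g &
      forall x, G x -> ball_at k.2.2 x -> A x].
apply: (@countable_keyed _ _ _ _ NG R) => //.
- move=> A /cosetsP[] [U NU [g Gg AU]]; have [n nU] := open_subgroup_ball (sf_open GN NU);
    have [m hm] := trunc_div g n.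
    exists (U, (true, trunc g m)); split=> //; exists g; split=> //; first exact/ball_at_trunc.
    move=> x Gx /ball_at_trunc/hm[xg _]; rewrite AU; apply/lcosetP; apply: nU => //.
    by apply: subgroupM => //; exact: subgroupV.
  exists (U, (false, trunc g m)); split=> //; exists g; split=> //; first exact/ball_at_trunc.
  move=> x Gx /ball_at_trunc/hm[_ xg]; rewrite AU; apply/rcosetP; apply: nU => //.
  by apply: subgroupM => //; exact: subgroupV.
- move=> A B [U [b sg]] /= NU [g [Gg Ag sgg gA]] [h [Gh Bh sgh hB]].
  have sU := subgroup_family_sub NU.
  have := gA h Gh sgh; rewrite Ag Bh /=; case: (b).
    exact: lcoset_eq.
  exact: rcoset_eq.
Qed.

End Cosets.

(** * The coset relation is Borel *)

Lemma subset_hits (A B : closedSinf) :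
  (A : set Sinf) `<=` B <-> forall sg, hits A sg -> hits B sg.
Proof.
split=> [AB sg /asboolP[s As ss]|AB s /mem_hits As]; last first.
  by apply/mem_hits => n; exact: AB.
by apply/asboolP; exists s => //; exact: AB.
Qed.

(** The closed set C contains a product as soon as it meets all its basic
    neighbourhoods, and these are forced by finite approximations of the factors. *)
Lemma setmul_sub_hits (A B C : closedSinf) : setmul A B `<=` C <->
  forall sg rh ta, (forall s t, ball_at sg s -> ball_at rh t -> ball_at ta (s * t)%g) ->
    hits A sg -> hits B rh -> hits C ta.
Proof.
split=> [ABC sg rh ta h /asboolP[s As ss] /asboolP[t Bt tt]|h _ [a Aa [b Bb <-]]].
  apply/asboolP; exists (s * t)%g; last exact: h.
  by apply: ABC; exists s => //; exists t.
apply/mem_hits => n; have [m hm] := trunc_mul a b n.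
apply: (h (trunc a m) (trunc b m)); [|exact: (mem_hits _ _).1|exact: (mem_hits _ _).1].
by move=> s t /ball_at_trunc sa /ball_at_trunc tb; apply/ball_at_trunc; exact: hm.
Qed.

Section BorelRelations.
Context {d : measure_display} {T : measurableType d}.
Implicit Types f g h : T -> closedSinf.

Definition borel_closed f := forall sg, measurable [set x | hits (f x) sg].

Lemma measurable_setmul_sub f g h : borel_closed f -> borel_closed g -> borel_closed h ->
  measurable [set x | setmul (f x) (g x) `<=` h x].
Proof.
move=> mf mg mh; apply: (measurable_equivP (fun x => setmul_sub_hits _ _ _)).
do 3 (apply: measurable_forall => ?).
apply: measurable_implP; first exact: measurable_constP.
by apply: measurable_implP => //; exact: measurable_implP.
Qed.

Lemma measurable_subset f g : borel_closed f -> borel_closed g ->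
  measurable [set x | (f x : set Sinf) `<=` g x].
Proof.
move=> mf mg; apply: (measurable_equivP (fun x => subset_hits _ _)).
by apply: measurable_forall => ?; exact: measurable_implP.
Qed.

Lemma measurable_eq_closed f g : borel_closed f -> borel_closed g ->
  measurable [set x | f x = g x].
Proof.
move=> mf mg; rewrite (_ : [set x | _] =
    [set x | (f x : set Sinf) `<=` g x /\ (g x : set Sinf) `<=` f x]).
  by apply: measurable_andP; exact: measurable_subset.
apply/seteqP; split=> x /=; first by move=> ->; split.
by move=> [fg gf]; apply: closedSinf_ext; apply/seteqP; split.
Qed.

Lemma borel_closed_fun f : borel_closed f <-> measurable_fun setT f.
Proof.
split=> [mf|mf sg]; first by apply: measurable_fun_closedSinf => // sg; rewrite setTI.
by rewrite -[X in measurable X]setTI; exact: (mf measurableT _ (measurable_hits sg)).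
Qed.

End BorelRelations.

(** Left and right quotients are images of a set under [q], and only the
    continuity of [q] matters for the Borel computation of their closure. *)
Section Quotients.
Variable q : Sinf -> Sinf -> Sinf.
Hypothesis q_cont : forall s t n, exists m, forall s' t',
  trunc s' m = trunc s m -> trunc t' m = trunc t m -> trunc (q s' t') n = trunc (q s t) n.

Definition quotient_closure (A : set Sinf) : closedSinf :=
  mk_closedSinf (@closed_closure _ [set x | exists a b, [/\ A a, A b & x = q a b]]).

Lemma hits_quotient_closure (A : closedSinf) ta :
  hits (quotient_closure A) ta <-> exists sg rh,
  [/\ forall s t, ball_at sg s -> ball_at rh t -> ball_at ta (q s t), hits A sg & hits A rh].
Proof.
split=> [/asboolP[x Ax xta]|[sg [rh [h /asboolP[s As ss] /asboolP[t At tt]]]]].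
  have [_ [[a [b [Aa Ab ->]]] abx]] := Ax _ (trunc_nbhs x (size ta)).
  have [m hm] := q_cont a b (size ta).
  exists (trunc a m), (trunc b m); split; [|exact: (mem_hits _ _).1|exact: (mem_hits _ _).1].
  move=> s t /ball_at_trunc sa /ball_at_trunc tb.
  by rewrite /ball_at /= (hm _ _ sa tb) abx.
apply/asboolP; exists (q s t); last exact: h.
by apply: subset_closure; exists s, t.
Qed.

Lemma borel_quotient_closure d (T : measurableType d) (f : T -> closedSinf) :
  borel_closed f -> borel_closed (fun x => quotient_closure (f x)).
Proof.
move=> mf ta; rewrite (_ : [set x | _] = [set x | exists sg, exists rh,
    (forall s t, ball_at sg s -> ball_at rh t -> ball_at ta (q s t)) /\
    (hits (f x) sg /\ hits (f x) rh)]).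
  do 2 (apply: measurable_exists => ?).
  by apply: measurable_andP; [exact: measurable_constP|exact: measurable_andP].
apply/seteqP; split=> x /=.
  by move=> /hits_quotient_closure[sg [rh [? ? ?]]]; exists sg, rh.
by move=> [sg [rh [? [? ?]]]]; apply/hits_quotient_closure; exists sg, rh.
Qed.
End Quotients.

Lemma lquotient_cont s t n : exists m, forall s' t', trunc s' m = trunc s m ->
  trunc t' m = trunc t m -> trunc (s'^-1 * t')%g n = trunc (s^-1 * t)%g n.
Proof.
have [m hm] := trunc_mul (s^-1)%g t n; exists m => s' t' /trunc_inv ss tt; exact: hm.
Qed.

Lemma rquotient_cont s t n : exists m, forall s' t', trunc s' m = trunc s m ->
  trunc t' m = trunc t m -> trunc (s' * t'^-1)%g n = trunc (s * t^-1)%g n.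
Proof.
have [m hm] := trunc_mul s (t^-1)%g n; exists m => s' t' ss /trunc_inv tt; exact: hm.
Qed.

Section CosetRelation.
Variables (V : set closedSinf) (N : closedSinf -> set (set Sinf)).
Hypothesis VN : forall G, V G -> subgroup_family G (N G).
Hypothesis Tborel : measurable
  [set p : closedSinf * closedSinf | V p.1 /\ N p.1 (p.2 : set Sinf)].

Definition coset_relation : set (closedSinf * closedSinf) :=
  [set p : closedSinf * closedSinf | V p.1 /\ cosets p.1 (N p.1) (p.2 : set Sinf)].

Let borel1 : borel_closed (fst : closedSinf * closedSinf -> closedSinf).
Proof. by apply/borel_closed_fun; exact: measurable_fst. Qed.

Let borel2 : borel_closed (snd : closedSinf * closedSinf -> closedSinf).
Proof. by apply/borel_closed_fun; exact: measurable_snd. Qed.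

Let measurable_family (f : closedSinf * closedSinf -> closedSinf) : borel_closed f ->
  measurable [set p : closedSinf * closedSinf | V p.1 /\ N p.1 (f p : set Sinf)].
Proof.
move=> mf; have mp : measurable_fun setT (fun p => (p.1, f p)).
  by apply/measurable_fun_pairP; split; [exact: measurable_fst|exact/borel_closed_fun].
by rewrite -[X in measurable X]setTI; exact: (mp measurableT _ Tborel).
Qed.

Lemma measurable_coset_relation : measurable coset_relation.
Proof.
pose lq (p : closedSinf * closedSinf) := quotient_closure (fun a b => a^-1 * b)%g p.2.
pose rq (p : closedSinf * closedSinf) := quotient_closure (fun a b => a * b^-1)%g p.2.
have mlq : borel_closed lq by apply: borel_quotient_closure => //; exact: lquotient_cont.
have mrq : borel_closed rq by apply: borel_quotient_closure => //; exact: rquotient_cont.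
rewrite (_ : coset_relation = [set p |
   ((V p.1 /\ N p.1 (lq p : set Sinf)) /\
    (hits p.2 [::] /\ ((p.2 : set Sinf) `<=` p.1 /\ setmul p.2 (lq p) `<=` p.2))) \/
   ((V p.1 /\ N p.1 (rq p : set Sinf)) /\
    (hits p.2 [::] /\ ((p.2 : set Sinf) `<=` p.1 /\ setmul (rq p) p.2 `<=` p.2)))]).
  apply: measurable_orP; apply: measurable_andP; try exact: measurable_family;
    (apply: measurable_andP; [exact: borel2|apply: measurable_andP];
    [exact: measurable_subset|exact: measurable_setmul_sub]).
have ne (A : closedSinf) : hits A [::] <-> (A : set Sinf) !=set0.
  by split=> [/asboolP[s As _]|[s As]]; [exists s|apply/asboolP; exists s].
apply/seteqP; split=> p /=.
  case=> Vp /cosetsP[/left_coset_char|/right_coset_char] /(_ (VN Vp))[/ne ? ? ? ?].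
    by left.
  by right.
case=> -[[Vp Np] [/ne ? [? ?]]]; split=> //; apply/cosetsP.
  by left; apply/(left_coset_char (VN Vp)).
by right; apply/(right_coset_char (VN Vp)).
Qed.

End CosetRelation.

(** * Enumerating a Borel relation with countable infinite sections *)

(** The j-th integer satisfying an unbounded predicate, j being counted as the
    number of smaller ones. *)
Lemma nth_true (P : pred nat) : (forall k, exists2 n, k <= n & P n) ->
  forall j, exists2 n, P n & count P (iota 0 n) = j.
Proof.
move=> Pinf; have next k : exists n, P n /\ count P (iota 0 n) = count P (iota 0 k).
  have [n0 kn0 Pn0] := Pinf k.
  have ex : exists n, (k <= n) && P n by exists n0; rewrite kn0.
  have [n /andP[kn Pn] nmin] := ex_minnP ex.
  exists n; split=> //; rewrite -(subnKC kn) iotaD count_cat add0n.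
  rewrite [X in _ + X](_ : _ = 0) ?addn0//.
  apply/eqP; rewrite -leqn0 leqNgt -has_count; apply/hasPn => i.
  rewrite mem_iota subnKC// => /andP[ki ltin]; apply: contraTN ltin => Pi.
  by rewrite -leqNgt nmin// ki.
elim=> [|j [n Pn nj]]; first by have [n [Pn]] := next 0; exists n.
have [m [Pm mn]] := next n.+1; exists m => //.
by rewrite mn -[n.+1]addn1 iotaD count_cat/= add0n Pn nj addn0 addn1.
Qed.

Lemma count_true_inj (P : pred nat) n m : P n -> P m ->
  count P (iota 0 n) = count P (iota 0 m) -> n = m.
Proof.
have lt k l : P k -> k < l -> count P (iota 0 k) < count P (iota 0 l).
  move=> Pk kl; rewrite -(subnKC kl) -[k.+1]addn1 -addnA !iotaD !count_cat/= add0n Pk.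
  by rewrite -{1}[count P _]addn0 ltn_add2l.
move=> Pn Pm e; case: (ltngtP n m) => // /lt; rewrite e ltnn => h.
  by have := h Pn.
by have := h Pm.
Qed.

(** The uniformizing functions list each section with repetitions; [fresh G n] keeps
    the first occurrences, and the j-th value is the fresh one with j fresh
    predecessors. *)
Lemma borel_enumeration_exists (V : set closedSinf) (S : set (closedSinf * closedSinf)) :
  measurable V -> measurable S -> (forall G, countable [set A | S (G, A)]) ->
  (forall G, V G -> infinite_set [set A | S (G, A)]) ->
  exists nu : closedSinf -> nat -> closedSinf,
    (forall G, V G -> set_bij setT [set A | S (G, A)] (nu G)) /\
    (forall j, measurable_fun V (fun G => nu G j)).
Proof.
move=> mV mS ctS infS.
have [f mf Sf] := lusin_novikov hits_inj hits_inj measurable_hits measurable_hits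
  borel_analytic_closedSinf (borel_analytic_closedSinf mS) ctS.
(* codes that are not pruned trees are sent to the empty set *)
have /choice[g gP] : forall n, exists g : closedSinf -> closedSinf, forall G,
    (pruned (f n G) -> hits (g G) = f n G) /\ (~ pruned (f n G) -> g G = closedSinf0).
  move=> n; suff /choice[g ?] : forall G, exists D,
     (pruned (f n G) -> hits D = f n G) /\ (~ pruned (f n G) -> D = closedSinf0) by exists g.
  move=> G; have [p|np] := pselect (pruned (f n G)); last by exists closedSinf0; split=> // /np.
  by have [D DE] := pruned_range p; exists D; split=> // /(_ p).
have mg n : borel_closed (g n).
  move=> sg; apply: (@measurable_equivP _ _ _ (fun G => pruned (f n G) /\ f n G sg)).
    move=> G; have [h1 h2] := gP n G; split=> [Gsg|[p]]; last by rewrite h1.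
    have [p|np] := pselect (pruned (f n G)); first by split=> //; rewrite -h1.
    by move: Gsg; rewrite h2// => /asboolP[].
  by apply: measurable_andP => //; exact: measurable_pruned.
have Sg G A : S (G, A) -> exists n, A = g n G.
  move=> /Sf[n /= An]; exists n; apply: hits_inj; rewrite (gP n G).1//.
  by rewrite -An; exact: pruned_hits.
pose fresh G n := `[< S (G, g n G) /\ forall m : 'I_n, g m G <> g n G >].
have mfresh n : measurable [set G | fresh G n].
  apply: (@measurable_equivP _ _ _ (fun G => S (G, g n G) /\
      forall m : 'I_n, ~ (g m G = g n G))).
    by move=> G; split=> /asboolP.
  apply: measurable_andP; last first.
    by apply: measurable_forall => m; apply: measurable_notP; apply: measurable_eq_closed; exact: mg.
  have mp : measurable_fun setT (fun G => (G, g n G)).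
    by apply/measurable_fun_pairP; split; [exact: measurable_id|apply/borel_closed_fun; exact: mg].
  by rewrite -[X in measurable X]setTI; exact: (mp measurableT _ mS).
have mcount n j : measurable [set G | count (fresh G) (iota 0 n) = j].
  elim: n j => [|n IH] j; first exact: measurable_constP (0 = j).
  apply: (@measurable_equivP _ _ _ (fun G =>
      (fresh G n /\ exists i, j = i.+1 /\ count (fresh G) (iota 0 n) = i) \/
      (~ fresh G n /\ count (fresh G) (iota 0 n) = j))).
    move=> G; rewrite -[n.+1]addn1 iotaD count_cat/= add0n addn0.
    case: (fresh G n); rewrite ?addn1 ?addn0.
      split=> [<-|[[_ [i [-> ->]]]|[]]] //; left; split=> //.
      by exists (count (fresh G) (iota 0 n)).
    by split=> [<-|[[]|[]]] //; right.
  apply: measurable_orP; apply: measurable_andP => //.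
    by apply: measurable_exists => i; apply: measurable_andP => //; exact: measurable_constP.
  exact: measurable_notP.
have first_occurrence G A : S (G, A) -> exists2 n, fresh G n & A = g n G.
  move=> SA; have ex : exists n, `[< A = g n G >].
    by have [n e] := Sg _ _ SA; exists n; apply/asboolP.
  have [n /asboolP An nmin] := ex_minnP ex; exists n => //.
  apply/asboolP; split; first by rewrite -An.
  move=> m e; have : n <= m by apply: nmin; apply/asboolP; rewrite e.
  by rewrite leqNgt ltn_ord.
have fresh_inf G : V G -> forall k, exists2 n, k <= n & fresh G n.
  move=> VG k; apply: contrapT => nk; apply: (infS G VG).
  apply: (@sub_finite_set _ _ ((fun n => g n G) @` `I_k)); last first.
    by apply: finite_image; exact: finite_II.
  move=> A /= /first_occurrence[n Gn ->]; exists n => //=; rewrite ltnNge.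
  by apply/negP => le; apply: nk; exists n.
have /choice[idx idxP] : forall Gj : closedSinf * nat, exists n, V Gj.1 ->
    fresh Gj.1 n /\ count (fresh Gj.1) (iota 0 n) = Gj.2.
  move=> [G j] /=; have [VG|nVG] := pselect (V G); last by exists 0.
  by have [n ? ?] := nth_true (fresh_inf G VG) j; exists n.
exists (fun G j => g (idx (G, j)) G); split=> [G VG|j].
  have idxG j : fresh G (idx (G, j)) /\ count (fresh G) (iota 0 (idx (G, j))) = j.
    exact: idxP (G, j) VG.
  split.
  - by move=> j _ /=; have [/asboolP[]] := idxG j.
  - move=> i j _ _ e; have [fi ci] := idxG i; have [fj cj] := idxG j.
    suff e' : idx (G, i) = idx (G, j) by rewrite -ci e' cj.
    move: fi fj => /asboolP[_ fi] /asboolP[_ fj].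
    have [lt|lt|//] := ltngtP (idx (G, i)) (idx (G, j)).
      by case: (fj (Ordinal lt)).
    by case: (fi (Ordinal lt)).
  - move=> A /= /first_occurrence[n Gn ->]; exists (count (fresh G) (iota 0 n)) => //.
    have [fi ci] := idxG (count (fresh G) (iota 0 n)).
    by rewrite (count_true_inj fi Gn ci).
apply: measurable_fun_closedSinf => // sg.
apply: (@measurable_equivP _ _ _ (fun G => V G /\ exists n,
    fresh G n /\ (count (fresh G) (iota 0 n) = j /\ hits (g n G) sg))).
  move=> G; split=> -[VG]; have [/= fi ci] := idxP (G, j) VG.
    by split=> //; exists (idx (G, j)).
  by case=> n [fn [cn Gsg]]; split=> //=; rewrite (count_true_inj fi fn)// ci.
apply: measurable_andP => //; apply: measurable_exists => n.
by apply: measurable_andP => //; apply: measurable_andP => //; exact: mg.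
Qed.

Section Coding.
Variables (V : set closedSinf) (N : closedSinf -> set (set Sinf)).
Hypothesis VN : forall G, V G -> subgroup_family G (N G).
Hypothesis Vborel : measurable V.

Lemma borel_enumeration_cosets :
  (forall G, V G -> (N G #= [set: nat])%card) ->
  measurable [set p : closedSinf * closedSinf | V p.1 /\ N p.1 (p.2 : set Sinf)] ->
  exists nu, borel_enumeration V N nu.
Proof.
move=> cardN Tborel.
have cardN_countable G : V G -> countable (N G).
  by move=> /cardN/card_eqPle[].
have [|G VG|nu [nuP mnu]] := @borel_enumeration_exists V (coset_relation V N) Vborel
    (measurable_coset_relation VN Tborel).
- move=> G; have [VG|nVG] := pselect (V G); last first.
    by rewrite (_ : [set A | _] = set0)//; apply/seteqP; split=> // A [].
  have := countable_cosets (VN VG) (cardN_countable G VG).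
  move=> /countable_injP[e e_inj]; apply/countable_injP; exists (e \o set_of_closed).
  move=> A B /set_mem[_ GA] /set_mem[_ GB] eAB; apply: closedSinf_ext.
  by apply: e_inj => //; exact: mem_set.
- move=> fin; have : infinite_set (N G).
    by rewrite (eq_finite_set (cardN G VG)); exact: infinite_nat.
  apply; apply: (@sub_finite_set _ _ (set_of_closed @` [set A | coset_relation V N (G, A)])).
    move=> U NU; have GU := family_coset (VN VG) NU.
    by exists (mk_closedSinf (closed_coset (VN VG) GU)).
  exact: finite_image.
- exists nu; split.
    move=> G VG; have [nu1 nu2 nu3] := nuP G VG; split.
    + by move=> n _; have [] := nu1 n I.
    + by move=> i j Ti Tj e; apply: nu2 => //; exact: closedSinf_ext e.
    + move=> A GA; have clA := closed_coset (VN VG) GA.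
      by have [|n _ e] := nu3 (mk_closedSinf clA); [|exists n => //; rewrite e].
  apply: (@measurability _ _ _ (g_sigma_algebraType cylinders) V nu cylinders) => // _ [_ [n _ [B mB <-]] <-].
  exact: mnu.
Qed.

(** Open sets are countable unions of cylinders, given by n values listed in b. *)
Lemma open_ternary (O : set ternary_omega) f : open O ->
  O f <-> exists n (b : seq bool), 
    (forall g : ternary_omega,
      (forall t, pickle t < n -> g t = nth false b (pickle t)) -> O g) /\
    (forall t, pickle t < n -> f t = nth false b (pickle t)).
Proof.
move=> oO; split=> [Of|[n [b [h hf]]]]; last exact: h.
have pk : injective (@pickle (nat * nat * nat)%type) by exact: pcan_inj pickleK.
have /(nbhs_ptws pk)[n nO] : nbhs (f : {ptws nat * nat * nat -> bool}) O.
  by move: oO; rewrite openE; exact.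
pose b := mkseq (fun k => if @unpickle (nat * nat * nat)%type k is Some t then f t else false) n.
have fb t : pickle t < n -> f t = nth false b (pickle t).
  by move=> lt; rewrite nth_mkseq// pickleK.
by exists n, b; split=> // g gb; apply: nO => t lt; rewrite gb// fb.
Qed.

(** [nu'] extends the enumeration by the empty set outside V, so that
    its coordinates are Borel on the whole space. *)
Lemma measurable_coded_structure nu : borel_enumeration V N nu ->
  measurable_fun V (coded_coset_structure nu : closedSinf -> borel_ternary_omega).
Proof.
move=> [_ mnu]; pose nu' j G := if `[< V G >] then nu G j else closedSinf0.
have nu'E G j : V G -> nu' j G = nu G j by move=> VG; rewrite /nu' asboolT.
have mnu' j : borel_closed (nu' j).
  move=> sg; apply: (@measurable_equivP _ _ _ (fun G => V G /\ hits (nu G j) sg)).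
    move=> G; rewrite /nu'; case: asboolP => VG; first by split=> [|[]].
    by split=> [/asboolP[]|[]].
  apply: (mnu Vborel [set s | hits (s j) sg]).
  by apply: sub_sigma_algebra; exists j => //; exists [set D | hits D sg] => //;
     exact: measurable_hits.
apply: (@measurability _ _ _ borel_ternary_omega V _ (@open ternary_omega)) => // _ [O oO <-].
apply: (@measurable_equivP _ _ _ (fun G => V G /\ exists n b,
    (forall g : ternary_omega,
      (forall t, pickle t < n -> g t = nth false b (pickle t)) -> O g) /\
    (forall t, pickle t < n ->
      (setmul (nu' t.1.1 G) (nu' t.1.2 G) `<=` nu' t.2 G) <-> nth false b (pickle t)))).
  move=> G; split=> -[VG].
    move=> /(open_ternary _ oO)[n [b [h hf]]]; split=> //; exists n, b; split=> // t lt.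
    by rewrite -hf// !nu'E//; split=> /asboolP.
  move=> [n [b [h hf]]]; split=> //; apply/open_ternary => //; exists n, b; split=> // t lt.
  apply/idP/idP => [/asboolP|]; first by rewrite -!nu'E// => /(hf t lt).
  by move=> /(hf t lt); rewrite !nu'E// => /asboolP.
apply: measurable_andP => //.
do 2 (apply: measurable_exists => ?); apply: measurable_andP; first exact: measurable_constP.
apply: measurable_forall => t; apply: measurable_implP; first exact: measurable_constP.
by apply: measurable_iffP; [exact: measurable_setmul_sub|exact: measurable_constP].
Qed.

End Coding.

(** * Recovering a group from its cosets *)

Definition conjugate (g : Sinf) (U : set Sinf) : set Sinf :=
  [set (g * u * g^-1)%g | u in U].

Record coset_family (G : set Sinf) (NG : set (set Sinf)) : Prop := CosetFamily {
  cf_family : subgroup_family G NG;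
  cf_small : forall n, exists2 U, NG U & forall x, U x -> trunc x n = trunc 1%g n;
  cf_conj : forall U g, NG U -> G g -> NG (conjugate g U) }.

Lemma conjugateP g U x : conjugate g U x <-> U (g^-1 * x * g)%g.
Proof.
split=> [[u Uu <-]|Ux]; first by rewrite -mulgA mulgVK mulKg.
by exists (g^-1 * x * g)%g => //; rewrite -!mulgA mulgV mulg1 mulVKg.
Qed.

Lemma rcoset_lcoset U g : rcoset U g = lcoset g (conjugate (g^-1)%g U).
Proof.
apply/seteqP; split=> x; rewrite rcosetP lcosetP conjugateP invgK;
  by rewrite mulVKg.
Qed.

Section CosetFamily.
Variables (G : set Sinf) (NG : set (set Sinf)).
Hypothesis GN : coset_family G NG.
Let GN' := cf_family GN.
Let sG := sf_group GN'.
Let sU := subgroup_family_sub GN'.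
Local Notation cosetG := (cosets G NG).

(** Right cosets are left cosets of a conjugate subgroup. *)
Lemma coset_left A x : cosetG A -> A x -> exists2 U, NG U & A = lcoset x U.
Proof.
move=> /cosetsP[] [U NU [g Gg ->]].
  by move=> Ax; exists U => //; exact: lcoset_eq (sU NU) Ax.
rewrite rcoset_lcoset => Ax.
have NV : NG (conjugate (g^-1)%g U) by apply: (cf_conj GN) => //; exact: subgroupV.
by exists (conjugate (g^-1)%g U) => //; exact: lcoset_eq (sU NV) Ax.
Qed.

Lemma coset_nonempty A : cosetG A -> A !=set0.
Proof.
move=> /cosetsP[] [U NU [g Gg ->]]; exists g.
  by apply/lcosetP; rewrite mulVg; exact: subgroup1 (sU NU).
by apply/rcosetP; rewrite mulgV; exact: subgroup1 (sU NU).
Qed.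

Lemma mem_lcoset g U : NG U -> lcoset g U g.
Proof. by move=> NU; apply/lcosetP; rewrite mulVg; exact: subgroup1 (sU NU). Qed.

Lemma mem_rcoset g U : NG U -> rcoset U g g.
Proof. by move=> NU; apply/rcosetP; rewrite mulgV; exact: subgroup1 (sU NU). Qed.

Lemma family_inter U U' : NG U -> NG U' -> exists2 W, NG W & W `<=` U `&` U'.
Proof.
move=> NU NU'; have [n nU] := open_subgroup_ball (sf_open GN' NU).
have [m mU] := open_subgroup_ball (sf_open GN' NU').
have [W NW Wnm] := cf_small GN (maxn n m); exists W => // x Wx.
have Gx := sub_family GN' NW Wx; have xnm := Wnm x Wx.
split; [apply: nU => //; exact: trunc_le (leq_maxl _ _) xnm|].
by apply: mU => //; exact: trunc_le (leq_maxr _ _) xnm.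
Qed.

Lemma coset_inter A B x : cosetG A -> cosetG B -> A x -> B x ->
  exists C, [/\ cosetG C, C x, C `<=` A & C `<=` B].
Proof.
move=> cA cB Ax Bx; have [U NU AU] := coset_left cA Ax; have [U' NU' BU'] := coset_left cB Bx.
have [W NW WU] := family_inter NU NU'; exists (lcoset x W); split.
- by apply: lcoset_coset => //; exact: sub_coset GN' _ cA _ Ax.
- exact: mem_lcoset.
- by rewrite AU => y /lcosetP/WU[? _]; apply/lcosetP.
- by rewrite BU' => y /lcosetP/WU[_ ?]; apply/lcosetP.
Qed.

(** A coset gW closed under products contains g g, so g lies in W. *)
Lemma family_mul U : cosetG U -> NG U <-> setmul U U `<=` U.
Proof.
move=> cU; split=> [NU _ [u Uu [v Uv <-]]|UU]; first exact: subgroupM (sU NU) Uu Uv.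
have [g Ug] := coset_nonempty cU; have [W NW UW] := coset_left cU Ug.
have : U (g * g)%g by apply: UU; exists g => //; exists g.
rewrite UW lcosetP mulKg => Wg; rewrite (_ : lcoset g W = W)//.
by rewrite -[RHS]lcoset1; apply/esym/lcoset_eq; [exact: sU|rewrite lcoset1].
Qed.

(** The left side says that A lies in a left coset of U, in terms of R alone. *)
Lemma left_smallP A U : cosetG A -> NG U ->
  (exists2 B, cosetG B & setmul B A `<=` U) <-> forall x y, A x -> A y -> U (x^-1 * y)%g.
Proof.
move=> cA NU; split=> [[B cB BA] x y Ax Ay|h].
  have [b Bb] := coset_nonempty cB; rewrite -(mulKg b y) mulgA -invgM.
  by apply: subgroupM (sU NU) _ _; [apply: subgroupV (sU NU) _|];
    apply: BA; exists b => //; [exists x|exists y].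
have [a Aa] := coset_nonempty cA; exists (rcoset U (a^-1)%g).
  by apply: rcoset_coset => //; apply: subgroupV => //; exact: sub_coset GN' _ cA _ Aa.
move=> _ [_ [u Uu <-] [y Ay <-]]; rewrite -mulgA; apply: subgroupM (sU NU) Uu _.
exact: h.
Qed.

Lemma right_smallP A U : cosetG A -> NG U ->
  (exists2 B, cosetG B & setmul A B `<=` U) <-> forall x y, A x -> A y -> U (x * y^-1)%g.
Proof.
move=> cA NU; split=> [[B cB BA] x y Ax Ay|h].
  have [b Bb] := coset_nonempty cB; rewrite -(mulgK b x) -mulgA -invgM.
  by apply: subgroupM (sU NU) _ _; [|apply: subgroupV (sU NU) _];
    apply: BA; [exists x|exists y] => //; exists b.
have [a Aa] := coset_nonempty cA; exists (lcoset (a^-1)%g U).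
  by apply: lcoset_coset => //; apply: subgroupV => //; exact: sub_coset GN' _ cA _ Aa.
move=> _ [y Ay [_ [u Uu <-] <-]]; rewrite mulgA; apply: subgroupM (sU NU) _ Uu.
exact: h.
Qed.

Lemma open_coset A x : cosetG A -> A x ->
  exists n, forall y, G y -> trunc y n = trunc x n -> A y.
Proof.
move=> cA Ax; have [U NU AU] := coset_left cA Ax.
have [n nU] := open_subgroup_ball (sf_open GN' NU); have [m hm] := trunc_div x n.
have Gx := sub_coset GN' cA Ax.
exists m => y Gy /hm[yx _]; rewrite AU; apply/lcosetP; apply: nU => //.
by apply: subgroupM => //; exact: subgroupV.
Qed.

End CosetFamily.

Record coset_iso (G : set Sinf) (NG : set (set Sinf)) (H : set Sinf)
    (NH : set (set Sinf)) (f f' : set Sinf -> set Sinf) : Prop := CosetIso {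
  ci_map : forall A, cosets G NG A -> cosets H NH (f A);
  ci_inv_map : forall B, cosets H NH B -> cosets G NG (f' B);
  ci_K : forall A, cosets G NG A -> f' (f A) = A;
  ci_inv_K : forall B, cosets H NH B -> f (f' B) = B;
  ci_mul : forall A B C, cosets G NG A -> cosets G NG B -> cosets G NG C ->
    setmul A B `<=` C -> setmul (f A) (f B) `<=` f C;
  ci_inv_mul : forall A B C, cosets H NH A -> cosets H NH B -> cosets H NH C ->
    setmul A B `<=` C -> setmul (f' A) (f' B) `<=` f' C }.

Lemma coset_iso_sym G NG H NH f f' :
  coset_iso G NG H NH f f' -> coset_iso H NH G NG f' f.
Proof. by case. Qed.

(** The left quotient controls the values, the right quotient those of
    the inverses. *)
Lemma trunc_two_sided (W : set Sinf) n h k :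
  (forall x, W x -> trunc x n = trunc 1%g n) ->
  W (h^-1 * k)%g -> W (k * h^-1)%g -> trunc k n = trunc h n.
Proof.
move=> Wn /Wn/trunc_eqP lhk /Wn/trunc_eqP rhk; apply/trunc_eqP => i lt; split.
  by rewrite -[LHS](sinfVK h); have [+ _] := lhk i lt; rewrite sinf_mulE => ->.
have [_] := rhk i lt; rewrite invgM invgK invg1 sinf_mulE => e.
by rewrite -[LHS](sinfK h) e.
Qed.

Section CosetIsoLimit.
Variables (G : set Sinf) (NG : set (set Sinf)) (H : set Sinf) (NH : set (set Sinf)).
Variables f f' : set Sinf -> set Sinf.
Hypotheses (GN : coset_family G NG) (HN : coset_family H NH).
Hypothesis fI : coset_iso G NG H NH f f'.
Let GN' := cf_family GN.
Let HN' := cf_family HN.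
Local Notation cosetG := (cosets G NG).
Local Notation cosetH := (cosets H NH).

Lemma coset_iso_family U : NG U -> NH (f U).
Proof.
move=> NU; have cU := family_coset GN' NU.
apply/(family_mul HN (ci_map fI cU)); apply: (ci_mul fI) => //.
exact/(family_mul GN cU).
Qed.

(** If A = aU, the inclusion of A in B says that AU is contained in B. *)
Lemma coset_iso_mono A B : cosetG A -> cosetG B -> A `<=` B -> f A `<=` f B.
Proof.
move=> cA cB AB; have [a Aa] := coset_nonempty GN cA; have [U NU AU] := coset_left GN cA Aa.
have NfU := coset_iso_family NU.
have fAB : setmul (f A) (f U) `<=` f B.
  apply: (ci_mul fI) => //; first exact: family_coset.
  move=> _ [x Ax [u Uu <-]]; apply: AB; move: Ax; rewrite AU !lcosetP mulgA => Ux.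
  exact: subgroupM (subgroup_family_sub GN' NU) Ux Uu.
move=> x fAx; apply: fAB; exists x => //; exists 1%g; last by rewrite mulg1.
exact: subgroup1 (subgroup_family_sub HN' NfU).
Qed.

Lemma coset_iso_left_small A U : cosetG A -> NG U ->
  (forall x y, A x -> A y -> U (x^-1 * y)%g) ->
  forall x y, f A x -> f A y -> f U (x^-1 * y)%g.
Proof.
move=> cA NU /(left_smallP GN cA NU)[B cB BA].
apply/(left_smallP HN (ci_map fI cA) (coset_iso_family NU)).
exists (f B); first exact: (ci_map fI).
by apply: (ci_mul fI) => //; exact: family_coset.
Qed.

Lemma coset_iso_right_small A U : cosetG A -> NG U ->
  (forall x y, A x -> A y -> U (x * y^-1)%g) ->
  forall x y, f A x -> f A y -> f U (x * y^-1)%g.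
Proof.
move=> cA NU /(right_smallP GN cA NU)[B cB AB].
apply/(right_smallP HN (ci_map fI cA) (coset_iso_family NU)).
exists (f B); first exact: (ci_map fI).
by apply: (ci_mul fI) => //; exact: family_coset.
Qed.

(** Take W in N_H close to 1, its preimage U, and a coset around g
    inside both gU and Ug. *)
Lemma coset_iso_small g n : G g -> exists A, [/\ cosetG A, A g &
  forall h k, f A h -> f A k -> trunc k n = trunc h n].
Proof.
move=> Gg; have [W NW Wn] := cf_small HN n.
have NU := coset_iso_family; pose U := f' W.
have cW := family_coset HN' NW; have fU : f U = W by exact: (ci_inv_K fI).
have {}NU : NG U.
  have cU : cosetG U by exact: (ci_inv_map fI).
  apply/(family_mul GN cU); apply: (ci_inv_mul fI) => //; exact/(family_mul HN cW).
have sU := subgroup_family_sub GN' NU.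
have [C [cC Cg CL CR]] := coset_inter GN (lcoset_coset NU Gg) (rcoset_coset NU Gg)
  (mem_lcoset GN g NU) (mem_rcoset GN g NU).
exists C; split=> // h k Ch Ck; apply: (trunc_two_sided Wn).
  rewrite -fU; apply: (coset_iso_left_small cC NU) => // x y /CL/lcosetP Ux /CL/lcosetP Uy.
  rewrite -(mulKg (g^-1)%g y) mulgA -invgM.
  by apply: subgroupM sU (subgroupV sU Ux) Uy.
rewrite -fU; apply: (coset_iso_right_small cC NU) => // x y /CR/rcosetP Ux /CR/rcosetP Uy.
rewrite -(mulgK (g^-1)%g x) -mulgA -invgM.
by apply: subgroupM sU Ux (subgroupV sU Uy).
Qed.

Lemma coset_iso_common A B g : cosetG A -> cosetG B -> A g -> B g ->
  exists2 h, f A h & f B h.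
Proof.
move=> cA cB Ag Bg; have [C [cC Cg CA CB]] := coset_inter GN cA cB Ag Bg.
have [h Ch] := coset_nonempty HN (ci_map fI cC).
by exists h; [apply: (coset_iso_mono cC cA)|apply: (coset_iso_mono cC cB)].
Qed.

(** Points of the images of smaller and smaller cosets around g stabilize coordinatewise,
    together with their inverses, because two such images always meet. *)
Lemma coset_iso_limit g : G g -> exists h, forall A, cosetG A -> A g -> f A h.
Proof.
move=> Gg; have /choice[A AP] := fun n => coset_iso_small n Gg.
have /choice[k kP] : forall n, exists k, f (A n) k.
  by move=> n; have [cA _ _] := AP n; exact: coset_nonempty (ci_map fI cA).
have coh n m : n <= m -> trunc (k m) n = trunc (k n) n.
  move=> nm; have [cn gn sn] := AP n; have [cm gm sm] := AP m.
  have [h fn fm] := coset_iso_common cn cm gn gm.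
  by rewrite -(sn _ _ (kP n) fn) -(trunc_le nm (sm _ _ (kP m) fm)).
pose h i := k i.+1 i; pose h' i := inv (k i.+1) i.
have hE n i : i < n -> k n i = h i /\ inv (k n) i = h' i.
  by move=> /coh/trunc_eqP/(_ i (ltnSn i)).
have hK : cancel h h'.
  move=> i; pose n := (maxn i (h i)).+1.
  have [<- _] : k n i = h i /\ inv (k n) i = h' i by apply: hE; rewrite ltnS leq_maxl.
  have [e _] : k n i = h i /\ inv (k n) i = h' i by apply: hE; rewrite ltnS leq_maxl.
  by have [_ <-] := hE n (k n i) (etrans (congr1 (leq^~ n) (congr1 S e)) (leq_maxr _ _));
     rewrite sinfK.
have h'K : cancel h' h.
  move=> i; pose n := (maxn i (h' i)).+1.
  have [_ e] : k n i = h i /\ inv (k n) i = h' i by apply: hE; rewrite ltnS leq_maxl.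
  rewrite -e; have [<- _] : k n (inv (k n) i) = h (inv (k n) i) /\
      inv (k n) (inv (k n) i) = h' (inv (k n) i).
    by apply: hE; rewrite e ltnS leq_maxr.
  by rewrite sinfVK.
pose s := mk_sinf (Bijective hK h'K); exists s => B cB Bg.
have sE i : inv s i = h' i by rewrite -{1}(h'K i) (_ : h (h' i) = s (h' i))// sinfK.
have sk n : trunc s n = trunc (k n) n.
  by apply/trunc_eqP => i /hE[-> ->]; rewrite sE.
have cfB := ci_map fI cB.
apply: (closed_sinf (closed_coset HN' cfB)) => n; have [cn gn sn] := AP n.
have [t Bt nt] := coset_iso_common cB cn Bg gn.
by exists t => //; rewrite sk; exact: sn.
Qed.

Lemma coset_iso_limit_uniq g h k : G g -> (forall A, cosetG A -> A g -> f A h) ->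
  (forall A, cosetG A -> A g -> f A k) -> h = k.
Proof.
move=> Gg hP kP; apply: sinf_ext => i.
have [A [cA Ag sA]] := coset_iso_small i.+1 Gg.
have /trunc_eqP/(_ i (ltnSn i))[] := sA _ _ (hP A cA Ag) (kP A cA Ag).
by move=> ->.
Qed.

End CosetIsoLimit.

Section CosetIsoGroups.
Variables (G : set Sinf) (NG : set (set Sinf)) (H : set Sinf) (NH : set (set Sinf)).
Variables f f' : set Sinf -> set Sinf.
Hypotheses (GN : coset_family G NG) (HN : coset_family H NH).
Hypothesis fI : coset_iso G NG H NH f f'.
Let GN' := cf_family GN.
Let HN' := cf_family HN.
Local Notation cosetG := (cosets G NG).
Local Notation cosetH := (cosets H NH).

(** If A is a left coset of U and h lies in f A, then f (gU) lies in the left coset of f U through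
    h, hence in f A; applying the inverse of f gives that gU lies in A. *)
Lemma coset_iso_reflect g h : G g -> (forall A, cosetG A -> A g -> f A h) ->
  forall A, cosetG A -> f A h -> A g.
Proof.
move=> Gg hP A cA fAh; have [a Aa] := coset_nonempty GN cA.
have [U NU AU] := coset_left GN cA Aa.
have cB := lcoset_coset NU Gg; have Bg := mem_lcoset GN g NU.
have sU := subgroup_family_sub GN' NU; have cU := family_coset GN' NU.
have small : forall x y, lcoset g U x -> lcoset g U y -> U (x^-1 * y)%g.
  move=> x y /lcosetP Ux /lcosetP Uy; rewrite -(mulKg (g^-1)%g y) mulgA -invgM.
  exact: subgroupM sU (subgroupV sU Ux) Uy.
have fAU : setmul (f A) (f U) `<=` f A.
  apply: (ci_mul fI) => // _ [x Ax [u Uu <-]]; move: Ax; rewrite AU !lcosetP mulgA => Ux.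
  exact: subgroupM.
have fBA : f (lcoset g U) `<=` f A.
  move=> y fBy; apply: fAU; exists h => //; exists (h^-1 * y)%g; last by rewrite mulVKg.
  by apply: (coset_iso_left_small GN HN fI cB NU small) => //; exact: hP.
rewrite -(ci_K fI cA).
apply: (coset_iso_mono HN GN (coset_iso_sym fI) (ci_map fI cB) (ci_map fI cA) fBA).
by rewrite (ci_K fI cB).
Qed.

(** The graph of the isomorphism of groups induced by f. *)
Definition follows g h := H h /\ forall A, cosetG A -> A g <-> f A h.

Lemma follows_exists g : G g -> exists h, follows g h.
Proof.
move=> Gg; have [h hP] := coset_iso_limit GN HN fI Gg; exists h; split.
  have [U NU _] := cf_small GN 0; have cB := lcoset_coset NU Gg.
  exact: sub_coset HN' _ (ci_map fI cB) _ (hP _ cB (mem_lcoset GN g NU)).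
by move=> A cA; split; [exact: hP|exact: coset_iso_reflect].
Qed.

Lemma follows_uniq g h k : G g -> follows g h -> (forall A, cosetG A -> A g -> f A k) -> k = h.
Proof.
by move=> Gg [_ hP] kP; apply: (coset_iso_limit_uniq GN HN fI Gg) => // A cA Ag; exact/(hP A cA).
Qed.

(** A neighbourhood xyU of xy is the product of x(yUy^-1) and yU, which are both
    cosets as N_G is closed under conjugation. *)
Lemma follows_mul x y h k : G x -> G y -> follows x h -> follows y k ->
  forall A, cosetG A -> A (x * y)%g -> f A (h * k)%g.
Proof.
move=> Gx Gy [_ xh] [_ yk] C cC Cxy; have [U NU CU] := coset_left GN cC Cxy.
have NV := cf_conj GN NU Gy.
have cA := lcoset_coset NV Gx; have cB := lcoset_coset NU Gy.
apply: (@ci_mul _ _ _ _ _ _ fI _ _ C cA cB cC); last first.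
  exists h; first exact/(xh _ cA)/(mem_lcoset GN).
  by exists k => //; exact/(yk _ cB)/(mem_lcoset GN).
have sU := subgroup_family_sub GN' NU.
move=> _ [_ [_ [u Uu <-] <-] [_ [v Uv <-] <-]]; rewrite CU; apply/lcosetP.
have -> : ((x * y)^-1 * (x * (y * u * y^-1) * (y * v)) = u * v)%g.
  by rewrite invgM !mulgA !mulgVK mulVg mul1g.
exact: subgroupM sU Uu Uv.
Qed.

Lemma follows_cont phi : (forall g, G g -> follows g (phi g)) ->
  forall g n, G g -> exists m, forall x, G x -> trunc x m = trunc g m ->
    trunc (phi x) n = trunc (phi g) n.
Proof.
move=> phiP g n Gg; have [A [cA Ag sA]] := coset_iso_small GN HN fI n Gg.
have [m mA] := open_coset GN cA Ag; exists m => x Gx xg.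
by apply: sA; [apply/(phiP g Gg).2|apply/(phiP x Gx).2 => //; exact: mA].
Qed.

End CosetIsoGroups.

Lemma within_continuousP (G : set Sinf) (phi : Sinf -> Sinf) :
  {within G, continuous phi} <-> forall g n, G g -> exists m, forall x, G x ->
    trunc x m = trunc g m -> trunc (phi x) n = trunc (phi g) n.
Proof.
split=> [/subspace_continuousP phic g n Gg|h].
  have /nbhs_sinf[m hm] := phic g Gg _ (trunc_nbhs (phi g) n).
  by exists m => x Gx xg; exact: hm xg Gx.
apply/subspace_continuousP => g Gg O /nbhs_sinf[n nO].
have [m hm] := h g n Gg; apply/nbhs_sinf; exists m => x xg Gx.
by apply: nO; exact: hm.
Qed.

Lemma coset_iso_topgroup G NG H NH f f' : coset_family G NG -> coset_family H NH ->
  coset_iso G NG H NH f f' -> topgroup_isomorphic G H.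
Proof.
move=> GN HN fI; have fI' := coset_iso_sym fI.
have /choice[phi phiP] : forall g, exists h, G g -> follows G NG H f g h.
  move=> g; have [Gg|nGg] := pselect (G g); last by exists g.
  by have [h] := follows_exists GN HN fI Gg; exists h.
have /choice[psi psiP] : forall h, exists g, H h -> follows H NH G f' h g.
  move=> h; have [Hh|nHh] := pselect (H h); last by exists h.
  by have [g] := follows_exists HN GN fI' Hh; exists g.
have phiK g : G g -> psi (phi g) = g.
  move=> Gg; have [Hphi phig] := phiP g Gg.
  apply/esym/(follows_uniq HN GN fI' Hphi (psiP _ Hphi)) => B cB Bphi.
  by apply/(phig _ (ci_inv_map fI cB)); rewrite (ci_inv_K fI cB).
have psiK h : H h -> phi (psi h) = h.
  move=> Hh; have [Gpsi psih] := psiP h Hh.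
  apply/esym/(follows_uniq GN HN fI Gpsi (phiP _ Gpsi)) => A cA Apsi.
  by apply/(psih _ (ci_map fI cA)); rewrite (ci_K fI cA).
exists phi; split.
- split.
  + by move=> g Gg; exact: (phiP g Gg).1.
  + by move=> x y /set_mem Gx /set_mem Gy e; rewrite -(phiK x)// -(phiK y)// e.
  + by move=> h Hh; exists (psi h); [exact: (psiP h Hh).1|exact: psiK].
- move=> x y Gx Gy; apply/esym.
  have Gxy := subgroupM (sf_group (cf_family GN)) Gx Gy.
  apply: (follows_uniq GN HN fI Gxy (phiP _ Gxy)).
  exact: (follows_mul GN fI Gx Gy (phiP x Gx) (phiP y Gy)).
- by apply/within_continuousP; exact: follows_cont GN HN fI _ phiP.
- by exists psi => //; apply/within_continuousP; exact: follows_cont HN GN fI' _ psiP.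
Qed.

(** * Topological isomorphisms and isomorphisms of coset structures *)

Lemma topgroup_iso_sym G H phi : is_subgroup G -> topgroup_iso G H phi ->
  exists psi, [/\ topgroup_iso H G psi, forall x, G x -> psi (phi x) = x &
    forall y, H y -> phi (psi y) = y].
Proof.
move=> sG [[phi1 phi2 phi3] phiM phic [psi psiK psic]].
have psiE y : H y -> exists2 x, G x & phi x = y /\ psi y = x.
  by move=> /phi3[x Gx <-]; exists x => //; rewrite psiK.
exists psi; split=> //; last by move=> y /psiE[x _ [xy ->]].
split=> //.
- split.
  + by move=> y /psiE[x Gx [_ ->]].
  + by move=> y z /set_mem/psiE[x _ [<- ex]] /set_mem/psiE[x' _ [<- ex']]; rewrite ex ex' => ->.
  + by move=> x Gx; exists (phi x); [exact: phi1|exact: psiK].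
- move=> y z /psiE[x Gx [<- ->]] /psiE[x' Gx' [<- ->]].
  by rewrite -phiM// psiK//; exact: subgroupM.
- by exists phi => // y /psiE[x Gx [<- ->]].
Qed.

Lemma image_lcoset G H phi g U : topgroup_iso G H phi -> G g -> U `<=` G ->
  phi @` lcoset g U = lcoset (phi g) (phi @` U).
Proof.
move=> [_ phiM _ _] Gg UG; apply/seteqP; split=> x.
  case=> _ [u Uu <-] <-; exists (phi u); first by exists u.
  by rewrite phiM//; exact: UG.
case=> _ [u Uu <-] <-; exists (g * u)%g; first by exists u.
by rewrite phiM//; exact: UG.
Qed.

Lemma image_rcoset G H phi g U : topgroup_iso G H phi -> G g -> U `<=` G ->
  phi @` rcoset U g = rcoset (phi @` U) (phi g).
Proof.
move=> [_ phiM _ _] Gg UG; apply/seteqP; split=> x.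
  case=> _ [u Uu <-] <-; exists (phi u); first by exists u.
  by rewrite phiM//; exact: UG.
case=> _ [u Uu <-] <-; exists (u * g)%g; first by exists u.
by rewrite phiM//; exact: UG.
Qed.

Lemma image_coset G NG H NH phi A : subgroup_family G NG -> topgroup_iso G H phi ->
  (forall U, NG U -> NH (phi @` U)) -> cosets G NG A -> cosets H NH (phi @` A).
Proof.
move=> GN phiI hN /cosetsP[] [U NU [g Gg ->]]; have [[phi1 _ _] _ _ _] := phiI.
  rewrite (image_lcoset phiI)//; last exact: sub_family GN _ NU.
  by apply: lcoset_coset; [exact: hN|exact: phi1].
rewrite (image_rcoset phiI)//; last exact: sub_family GN _ NU.
by apply: rcoset_coset; [exact: hN|exact: phi1].
Qed.

Lemma image_setmul G H phi A B C : topgroup_iso G H phi -> A `<=` G -> B `<=` G ->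
  setmul A B `<=` C -> setmul (phi @` A) (phi @` B) `<=` phi @` C.
Proof.
move=> [_ phiM _ _] AG BG ABC _ [_ [a Aa <-] [_ [b Bb <-] <-]].
exists (a * b)%g; first by apply: ABC; exists a => //; exists b.
by rewrite phiM//; [exact: AG|exact: BG].
Qed.

Lemma image_cancel G (phi psi : Sinf -> Sinf) A : A `<=` G ->
  (forall x, G x -> psi (phi x) = x) -> psi @` (phi @` A) = A.
Proof.
move=> AG psiK; apply/seteqP; split=> x.
  by case=> _ [y Ay <-] <-; rewrite psiK//; exact: AG.
by move=> Ax; exists (phi x); [exists x|rewrite psiK//; exact: AG].
Qed.

Lemma topgroup_coset_iso G NG H NH phi psi :
  subgroup_family G NG -> subgroup_family H NH ->
  topgroup_iso G H phi -> topgroup_iso H G psi ->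
  (forall x, G x -> psi (phi x) = x) -> (forall y, H y -> phi (psi y) = y) ->
  (forall U, NG U -> NH (phi @` U)) -> (forall W, NH W -> NG (psi @` W)) ->
  coset_iso G NG H NH (fun A => phi @` A) (fun B => psi @` B).
Proof.
move=> GN HN phiI psiI psiK phiK hN hN'; split.
- by move=> A; exact: image_coset.
- by move=> A; exact: image_coset.
- by move=> A cA; apply: (image_cancel (sub_coset GN cA)).
- by move=> A cA; apply: (image_cancel (sub_coset HN cA)).
- by move=> A B C cA cB _; exact: image_setmul phiI (sub_coset GN cA) (sub_coset GN cB).
- by move=> A B C cA cB _; exact: image_setmul psiI (sub_coset HN cA) (sub_coset HN cB).
Qed.

Lemma conjugation_iso G g : is_subgroup G -> G g ->
  topgroup_iso G G (fun x => g * x * g^-1)%g.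
Proof.
move=> sG Gg; have cont h : {within G, continuous (fun x : Sinf => h * x * h^-1 : Sinf)%g}.
  apply/within_continuousP => x n _; have [m hm] := trunc_mul (h * x)%g (h^-1)%g n.
  have [k hk] := trunc_mul h x m; exists k => y _ yx; apply: hm => //; exact: hk.
have GJ (h x : Sinf) : G h -> G x -> G (h * x * h^-1)%g.
  move=> Gh Gx; apply: (subgroupM sG); first exact: subgroupM.
  exact: subgroupV.
have JK (h x : Sinf) : (h^-1 * (h * x * h^-1) * (h^-1)^-1 = x)%g.
  by rewrite invgK !mulgA mulVg mul1g mulgVK.
split=> //.
- split.
  + by move=> x Gx; exact: GJ.
  + by move=> x y _ _ e; rewrite -(JK g x) e JK.
  + move=> x Gx; exists (g^-1 * x * (g^-1)^-1)%g; first by apply: GJ => //; exact: subgroupV.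
    by have := JK (g^-1)%g x; rewrite !invgK.
- by move=> x y _ _; rewrite !mulgA mulgVK.
- by exists (fun x => g^-1 * x * (g^-1)^-1)%g.
Qed.

(** Total on sets, so that inverse maps compose without carrying proofs. *)
Definition extend_sets (P Q : set (set Sinf)) (F : P -> Q) (A : set Sinf) : set Sinf :=
  if pselect (P A) is left PA then val (F (SigSub (mem_set PA))) else A.

Lemma extend_setsE (P Q : set (set Sinf)) (F : P -> Q) (a : P) :
  extend_sets F (val a) = val (F a).
Proof.
rewrite /extend_sets; case: pselect => [Pa|]; last by case; exact: set_valP.
by congr (val (F _)); exact: val_inj.
Qed.

Lemma ternary_isoP G NG H NH :
  ternary_iso (coset_structure G NG) (coset_structure H NH) <->
  exists f f', coset_iso G NG H NH f f'.
Proof.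
split=> [[F [F' FK F'K] FM]|[f [f' fI]]].
  have sub (P : set (set Sinf)) A : P A -> exists a : P, val a = A.
    by move=> PA; exists (SigSub (mem_set PA)).
  exists (extend_sets F), (extend_sets F'); split.
  - by move=> A /sub[a <-]; rewrite extend_setsE; exact: set_valP.
  - by move=> A /sub[a <-]; rewrite extend_setsE; exact: set_valP.
  - by move=> A /sub[a <-]; rewrite !extend_setsE FK.
  - by move=> A /sub[a <-]; rewrite !extend_setsE F'K.
  - by move=> A B C /sub[a <-] /sub[b <-] /sub[c <-]; rewrite !extend_setsE => /FM.
  - move=> A B C /sub[a <-] /sub[b <-] /sub[c <-]; rewrite !extend_setsE => abc.
    by apply/FM; rewrite /= !F'K.
pose F (a : cosets G NG) : cosets H NH := SigSub (mem_set (ci_map fI (set_valP a))).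
pose F' (b : cosets H NH) : cosets G NG := SigSub (mem_set (ci_inv_map fI (set_valP b))).
exists F; first exists F'.
- by move=> a; apply: val_inj => /=; exact: (ci_K fI) (set_valP a).
- by move=> b; apply: val_inj => /=; exact: (ci_inv_K fI) (set_valP b).
- move=> a b c /=; split; first exact: (ci_mul fI (set_valP a) (set_valP b) (set_valP c)).
  move=> /(ci_inv_mul fI (ci_map fI (set_valP a)) (ci_map fI (set_valP b))
    (ci_map fI (set_valP c))).
  by rewrite !(ci_K fI)//; exact: set_valP.
Qed.

Theorem mainTheorem4 (V : set closedSinf) (N : closedSinf -> set (set Sinf))
  (Vborel : measurable V)
  (Vgroup : forall G, V G -> is_subgroup G)
  (Vconj : forall (G H : closedSinf) (g : Sinf), V G ->
     (H : set Sinf) = [set (g * x * g^-1)%g | x in (G : set Sinf)] -> V H)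
  (Nopen : forall G, V G -> forall U, N G U -> open_subgroup_of G U)
  (Ncountable : forall G, V G -> (N G #= [set: nat])%card)
  (Nbasis : forall G, V G -> nbhs_basis1 G (N G))
  (Tborel : measurable
     [set p : closedSinf * closedSinf | V p.1 /\ N p.1 (p.2 : set Sinf)])
  (Ninv : forall G H, V G -> V H -> forall phi, topgroup_iso G H phi ->
     forall U, open_subgroup_of G U -> (N G U <-> N H (phi @` U))) :
  [/\ exists nu, borel_enumeration V N nu,
      forall nu, borel_enumeration V N nu ->
        measurable_fun V
          (coded_coset_structure nu : closedSinf -> borel_ternary_omega) &
      forall G H, V G -> V H ->
        (topgroup_isomorphic G H <->
         ternary_iso (coset_structure G (N G)) (coset_structure H (N H)))].
Proof.
have VN G : V G -> subgroup_family G (N G).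
  by move=> VG; split; [exact: closedSinf_closed|exact: Vgroup|exact: (Nopen G VG)].
have VC G : V G -> coset_family G (N G).
  move=> VG; split; first exact: VN.
    move=> n; have [_] := Nbasis G VG; case/(_ [set x | trunc x n = trunc 1%g n]).
      by apply/nbhs_sinf; exists n.
    by move=> U NU Un; exists U.
  move=> U g NU Gg; have gI := conjugation_iso (Vgroup G VG) Gg.
  exact: (Ninv G G VG VG _ gI U (Nopen G VG U NU)).1 NU.
split.
- exact: borel_enumeration_cosets.
- by move=> nu; exact: measurable_coded_structure.
- move=> G H VG VH; split; last first.
    by move=> /ternary_isoP[f [f' fI]]; exact: coset_iso_topgroup (VC G VG) (VC H VH) fI.
  move=> [phi phiI]; have [psi [psiI psiK phiK]] := topgroup_iso_sym (Vgroup G VG) phiI.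
  apply/ternary_isoP; do 2 eexists.
  apply: (topgroup_coset_iso (VN G VG) (VN H VH) phiI psiI psiK phiK).
    by move=> U NU; exact: (Ninv G H VG VH _ phiI U (Nopen G VG U NU)).1 NU.
  by move=> W NW; exact: (Ninv H G VH VG _ psiI W (Nopen H VH W NW)).1 NW.
Qed.
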